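(* Let $\Phi$ satisfy condition $C$ with doubling constant $c_0$, let $(w,v)$ be weights on $\mathbb{R}^n$ satisfying condition $F$ with constants $\beta,c_1$, and pick $s,t$ such that $0<s\le1/2$, $1/2<t<1-s$, and $$c_0\Big(\frac{s}{1-t}\Big)^{\beta}<1.$$ Then for any measurable function $f$ and any cube $Q_0\subset\mathbb{R}^n$, with a constant $c$ independent of $\Phi$, $Q_0$, and $f$, $$\int_{Q_0}\Phi(|f(x)-m_f(t,Q_0)|)\,w(x)\,dx\le c\int_{Q_0}\Phi\big(M^{\sharp}_{0,s,Q_0}f(x)\big)\,v(x)\,dx.$$ Furthermore, if $f$ is such that $\lim_{Q\to\mathbb{R}^n}m_f(t,Q)=0$, we also have $$\int_{\mathbb{R}^n}\Phi(|f(x)|)\,w(x)\,dx\le c\int_{\mathbb{R}^n}\Phi\big(M^{\sharp}_{0,s}f(x)\big)\,v(x)\,dx.$$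
   Context: All cubes have sides parallel to the axes. A weight is a nonnegative locally integrable function. A continuous function $\Phi$ satisfies condition $C$ with doubling constant $c_0$ if it is increasing on $[0,\infty)$, $\Phi(0)=0$, and $\Phi(2\tau)\le c_0\Phi(\tau)$ for all $\tau>0$. Here $c_0,c_1,\beta,s,t$ are regarded as given. Condition $F$: the weights $(w,v)$ satisfy condition $F$ if there exist positive constants $c_1,\alpha,\beta$ with $0<\alpha<1$ such that for any cube $Q$ and measurable subset $E$ of $Q$ with $|E|\le\alpha|Q|$, $$\int_Ew(x)\,dx\le c_1\Big(\frac{|E|}{|Q|}\Big)^{\beta}\int_{Q\setminus E}v(x)\,dx.$$ The (maximal) median is $m_f(t,Q)=\sup\{M:|\{y\in Q:f(y)<M\}|\le t|Q|\}$. The local sharp maximal functions are $$M^{\sharp}_{0,s,Q_0}f(x)=\sup_{x\in Q,\,Q\subset Q_0}\ \inf_c\ \inf\{\alpha\ge0:|\{y\in Q:|f(y)-c|>\alpha\}|<s|Q|\}\quad(x\in Q_0),$$ $$M^{\sharp}_{0,s}f(x)=\sup_{x\in Q}\ \inf_c\ \inf\{\alpha\ge0:|\{y\in Q:|f(y)-c|>\alpha\}|<s|Q|\}\quad(x\in\mathbb{R}^n),$$ with suprema over cubes $Q$. The notation $Q\to\mathbb{R}^n$ means that the cubes $Q$ expand to fill $\mathbb{R}^n$. *)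

(* Defs.v *)
From HB Require Import structures.
From mathcomp Require Import all_boot all_order all_algebra.
From mathcomp Require Import all_classical all_reals all_analysis.

Set Implicit Arguments.
Unset Strict Implicit.
Unset Printing Implicit Defensive.

Import Order.TTheory GRing.Theory Num.Theory.
Import numFieldNormedType.Exports.

Local Open Scope classical_set_scope.
Local Open Scope ring_scope.

(* R^n with n >= 1 is 'rV[R]_n.+1. The library has no Lebesgue measure on it:
   it is obtained here from the outer measure defined by countable coverings
   with boxes, so that "measurable" below means Lebesgue measurable. *)
Section lebesgue_measure_on_Rn.
Context {R : realType} {n : nat}.
Local Notation Rn := 'rV[R]_n.+1.

Definition box (a b : Rn) : set Rn :=
  [set x | forall i, a 0 i <= x 0 i <= b 0 i].

(* The maximum gives volume 0 to the empty boxes. *)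
Definition box_volume (a b : Rn) : R :=
  \prod_(i < n.+1) Num.max (b 0 i - a 0 i) 0.

Definition box_cover (X : set Rn) : set (nat -> Rn * Rn) :=
  [set B | X `<=` \bigcup_k box (B k).1 (B k).2].

Definition lebesgue_outer (X : set Rn) : \bar R :=
  ereal_inf [set (\sum_(k <oo) (box_volume (B k).1 (B k).2)%:E)%E
            | B in box_cover X].

Let bv (p : Rn * Rn) : \bar R := (box_volume p.1 p.2)%:E.

Let bv_ge0 p : (0 <= bv p)%E.
Proof.
by rewrite lee_fin; apply: prodr_ge0 => i _; rewrite le_max lexx orbT.
Qed.

Lemma lebesgue_outer_ge0 X : (0 <= lebesgue_outer X)%E.
Proof.
by apply: le_ereal_inf_tmp => _ [B _ <-]; apply: nneseries_ge0 => k *; exact: bv_ge0.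
Qed.

Lemma lebesgue_outer0 : lebesgue_outer set0 = 0%E.
Proof.
apply/eqP; rewrite eq_le lebesgue_outer_ge0 andbT.
apply: ereal_inf_lbound; exists (fun=> (0, 0)); first by move=> x.
rewrite eseries0// => k _ _ /=.
by rewrite /box_volume big_ord_recl !mxE subrr maxxx mul0r.
Qed.

Lemma le_lebesgue_outer : {homo lebesgue_outer : A B / A `<=` B >-> (A <= B)%E}.
Proof.
move=> A B AB; apply/ereal_inf_le_tmp => x [C BC <-]; exists C => //.
exact: subset_trans BC.
Qed.

Lemma lebesgue_outer_sigma_subadditive : sigma_subadditive lebesgue_outer.
Proof.
move=> A; have [[i ioo]|] := pselect (exists i, lebesgue_outer (A i) = +oo%E).
  rewrite (eseries_pinfty _ _ ioo) ?leey// => k _.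
  by rewrite -ltNye (lt_le_trans _ (lebesgue_outer_ge0 _)).
rewrite -forallNE => Aoo.
suff add2e (e : {posnum R}) : (lebesgue_outer (\bigcup_k A k) <=
    \sum_(i <oo) lebesgue_outer (A i) + e%:num%:E)%E.
  by apply/lee_addgt0Pr => _/posnumP[].
rewrite (le_trans _ (epsilon_trick _ _ _))//; last first.
  by move=> k; exact: lebesgue_outer_ge0.
pose P k (B : nat -> Rn * Rn) := box_cover (A k) B /\
  (\sum_(j <oo) bv (B j) <= lebesgue_outer (A k) + (e%:num / (2 ^ k.+1)%:R)%:E)%E.
have [G PG] : {G : nat -> nat -> Rn * Rn & forall k, P k (G k)}.
  apply: (@choice _ _ P) => k; rewrite /P /lebesgue_outer.
  set S := (X in ereal_inf X).
  have Sfin : ereal_inf S \is a fin_num.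
    rewrite ge0_fin_numE; last exact: lebesgue_outer_ge0.
    by rewrite ltey; apply/eqP; exact: Aoo.
  have ek : (0 < e%:num / (2 ^ k.+1)%:R :> R)%R by [].
  have [x [B AB <-] xS] := lb_ereal_inf_adherent ek Sfin.
  by exists B; split => //; exact/ltW.
apply: (@le_trans _ _ (\esum_(i in setT) (bv \o uncurry G) i)%E).
  apply: ereal_inf_lbound => /=.
  have /card_esym/ppcard_eqP[f] := card_nat2.
  exists (uncurry G \o f).
    move=> t [i _ /(PG i).1[j _ Bt]]; exists (f^-1%FUN (i, j)) => //=.
    by rewrite invK ?inE.
  rewrite -(esum_pred_image (bv \o uncurry G) _ xpredT) ?[fun=> _]set_true//.
    by rewrite image_eq.
  by move=> i _; exact: bv_ge0.
rewrite (_ : esum _ _ = \sum_(i <oo) \sum_(j <oo) bv (G i j))%E; last first.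
  pose J : nat -> set (nat * nat) := fun i => [set (i, j) | j in setT].
  rewrite (_ : setT = \bigcup_k J k); last first.
    by rewrite predeqE => -[a b]; split => // _; exists a => //; exists b.
  rewrite esum_bigcupT /=; last 2 first.
    - apply/trivIsetP => i j _ _ ij.
      rewrite predeqE => -[k m] /=; split => //= -[] [_] _ [<-{k} _].
      by move=> [m' _] [] /esym/eqP; rewrite (negbTE ij).
    - by move=> p; exact: bv_ge0.
  rewrite -(image_id [set: nat]) -fun_true esum_pred_image//; last first.
    by move=> k _; apply: esum_ge0 => p _; exact: bv_ge0.
  apply: eq_eseriesr => /= j _.
  rewrite -(esum_pred_image (bv \o uncurry G) (pair j) predT)//=; last first.
    by move=> ? ? _ _; exact: (@can_inj _ _ _ snd).
  rewrite (_ : [set (j, i) | i in fun=> true] = J j)//.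
  by rewrite predeqE => -[a b]; split; move=> [i _ <-]; exists i.
by apply: lee_nneseries => k *; [apply: nneseries_ge0 => *; exact: bv_ge0|exact: (PG k).2].
Qed.

HB.instance Definition _ := isOuterMeasure.Build R Rn lebesgue_outer
  lebesgue_outer0 lebesgue_outer_ge0 le_lebesgue_outer
  lebesgue_outer_sigma_subadditive.

Definition lebesgue_outer_measure : {outer_measure set Rn -> \bar R} :=
  lebesgue_outer.

End lebesgue_measure_on_Rn.

(* R^n with the sigma-algebra of Lebesgue measurable sets; it is convertible
   to 'rV[R]_n.+1. *)
Notation lebesgueRn R n := (caratheodory_type (@lebesgue_outer_measure R n)).

Definition lebesgue {R : realType} {n : nat} :
  {measure set (lebesgueRn R n) -> \bar R} := @lebesgue_outer_measure R n.

Section medians_and_weights.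
Context {R : realType} {n : nat}.
Local Notation Rn := 'rV[R]_n.+1.
Local Notation LRn := (lebesgueRn R n).
Local Notation mu := (@lebesgue R n).
Implicit Types (f w v : LRn -> R) (Q D E : set LRn) (Phi : R -> R).

Definition cube Q : Prop :=
  exists (a : Rn) (l : R), 0 < l /\ Q = box a (a + const_mx l).

Definition weight w : Prop :=
  [/\ forall x, 0 <= w x, measurable_fun setT w &
      forall K : set Rn, compact K -> (\int[mu]_(x in K) `|w x|%:E < +oo)%E].

Definition condition_C Phi (c0 : R) : Prop :=
  [/\ {within `[0, +oo[, continuous Phi},
      {in `[0, +oo[ &, {homo Phi : x y / x <= y}},
      Phi 0 = 0 &
      forall tau, 0 < tau -> Phi (2 * tau) <= c0 * Phi tau].

(* Value of Phi at an extended nonnegative real, with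
   Phi (+oo) = lim_(tau -> +oo) Phi tau = sup_(tau >= 0) Phi tau. *)
Definition extend Phi (y : \bar R) : \bar R :=
  match y with
  | EFin r => (Phi r)%:E
  | +oo%E => ereal_sup [set (Phi r)%:E | r in `[0, +oo[]
  | -oo%E => 0%E
  end.

Definition condition_F w v (c1 beta : R) : Prop :=
  [/\ 0 < c1, 0 < beta &
    exists2 alpha : R, 0 < alpha < 1 &
      forall Q E, cube Q -> measurable E -> E `<=` Q ->
        (mu E <= alpha%:E * mu Q)%E ->
        (\int[mu]_(x in E) (w x)%:E <=
         (c1 * (fine (mu E) / fine (mu Q)) `^ beta)%:E *
         \int[mu]_(x in Q `\` E) (v x)%:E)%E].

Definition median f (t : R) Q : R :=
  sup [set M | (mu [set y | Q y /\ (f y < M)%R] <= t%:E * mu Q)%E].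

Definition oscillation (s : R) f Q : \bar R :=
  ereal_inf [set ereal_inf [set a%:E | a in
      [set a : R | 0 <= a /\
        (mu [set y | Q y /\ (a < `|f y - c|)%R] < s%:E * mu Q)%E]]
    | c in [set: R]].

(* Local sharp maximal function with cubes restricted to lie in D; D is a cube
   Q0 or, for the unrestricted operator, the whole space. *)
Definition sharp_maximal (s : R) D f (x : LRn) : \bar R :=
  ereal_sup [set oscillation s f Q | Q in
    [set Q | [/\ cube Q, Q `<=` D & Q x]]].

(* The filter "Q -> R^n" on cubes. *)
Definition cubes_to_Rn : set_system (set LRn) :=
  [set P | exists2 Q0, cube Q0 & forall Q, cube Q -> Q0 `<=` Q -> P Q].

End medians_and_weights.

(* Main.v *)
Require Import Defs.
From mathcomp Require Import all_boot all_order all_algebra.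
From mathcomp Require Import all_classical all_reals all_analysis.
From mathcomp Require Import measurable_realfun lra ring.
Import Order.TTheory GRing.Theory Num.Theory.
Import numFieldNormedType.Exports.
Local Open Scope classical_set_scope.
Local Open Scope ring_scope.
Set Implicit Arguments.
Unset Strict Implicit.
Unset Printing Implicit Defensive.

(** Why the estimate holds. Fix a cube [Q0], write [m Q] for the median and
    [lam Q] for the largest oscillation of [f] over the cubes between [Q] and
    [Q0]; [lam] increases when [Q] shrinks and is at most the sharp maximal
    function at every point of [Q]. The median is within the oscillation of any
    almost optimal constant, so that [|f - m Q| <= 2 lam Q] except on a proportion
    [s] of [Q] ([median_center]).

    Starting from [Q0], select inside each selected cube [Q] the maximal dyadic
    subcubes on which [|f - m Q| > 2 lam Q] holds on more than the proportion
    [1 - t]. Together they occupy at most the proportion [rho = s / (1 - t) < 1] of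
    [Q], hence the points of [Q] that lie in [e] further generations of selected
    cubes occupy at most [rho ^ e] ([gen_decay], [reach_decay]). The dyadic parent
    [P] of a selected cube [Q'] was not selected, which ties [m P] to [m Q], and
    [m P] is tied to [m Q'] by a chain of cubes growing from [Q'] to [P]
    ([median_double_cube]); altogether [|m Q' - m Q| <= C lam Q'] ([jump_le]).
    By a density argument ([dyadic_density]), [|f - m Q| <= 2 lam Q] holds almost
    everywhere on the last selected cube around a point. Therefore [|f - m Q0|] is
    almost everywhere at most a constant times the sum of [lam Q] over the
    selected cubes [Q] around the point.

    The doubling condition bounds [Phi] of this sum by the sum of
    [c0 ^ e * Phi (lam Q)] up to a constant, where [e] is the number of generations
    that follow [Q] around the point ([Phi_chain]). When this is integrated against
    [w], the coefficient of [Phi (lam Q)] for a given [e] is the [w]-mass of a part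
    of [Q] of proportion [rho ^ e], which condition F bounds by a constant times
    [rho ^ (beta e)] times the [v]-mass of the points of [Q] that are followed by
    less than [e + q] further generations, [q] being fixed ([weights_on_cells],
    [integral_stop_reaching_le]). A point is in that situation for at most [e + q] of its
    selected cubes, and [Phi (lam Q)] is at most [Phi] of the sharp maximal
    function; so the [v]-integral of the latter appears with the factor
    [sum_e (c0 rho ^ beta) ^ e (e + q)], which is finite by assumption
    ([stopping_time_estimate]).

    The estimate on the whole space follows by Fatou's lemma along the cubes
    centered at the origin ([global_from_local]).

    The selection is carried out pointwise, as a stopping time along the cells
    that shrink to [x], in an abstract measure space with nested countable
    partitions. Lebesgue measure being defined by coverings with boxes, the facts
    needed about it (volume of boxes, null faces, density) are proved from the
    definition. *)

(** * Generalities on measures and integrals *)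

Section countable_fibers.
Context d (T : measurableType d) (R : realType) (mu : {measure set T -> \bar R}).
Context (p : T -> nat) (mp : forall j, measurable [set x | p x = j]).
Local Notation fiber x := [set y | p y = p x].
Implicit Types (A B : set T) (g h : T -> \bar R).

Lemma bigcup_fibers A : \bigcup_j (A `&` [set x | p x = j]) = A.
Proof. by apply/seteqP; split => [x [j _ []]//|x Ax]; exists (p x). Qed.

Lemma trivIset_fibers A : trivIset setT (fun j => A `&` [set x | p x = j]).
Proof.
apply/trivIsetP => i j _ _ /eqP ij; rewrite -subset0 => x [[_ /= pi] [_ /= pj]].
by apply: ij; rewrite -pi -pj.
Qed.

(** An inequality between measures may be checked cell by cell on the countable
    partition given by the fibers of [p]; the cells are named by their points,
    so that no enumeration of them is ever needed. *)
Lemma le_measure_fibers A B (c : R) : measurable A -> measurable B -> 0 <= c ->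
  (forall x, A x -> (mu (A `&` fiber x) <= c%:E * mu (B `&` fiber x))%E) ->
  (mu A <= c%:E * mu B)%E.
Proof.
move=> mA mB c0 AB.
rewrite -[in leLHS](bigcup_fibers A) -[in leRHS](bigcup_fibers B).
rewrite !measure_semi_bigcup//; try exact: trivIset_fibers; first last.
- by rewrite bigcup_fibers.
- by move=> j; exact: measurableI.
- by rewrite bigcup_fibers.
- by move=> j; exact: measurableI.
rewrite -nneseriesZl//; apply: lee_nneseries => // j _.
have [A0|/set0P[x [Ax /= <-]]] := eqVneq (A `&` [set x | p x = j]) set0; last exact: AB.
by rewrite A0 measure0 mule_ge0.
Qed.

Lemma le_integral_fibers A B g h (c : R) : measurable A -> measurable B -> 0 <= c ->
  measurable_fun A g -> measurable_fun B h ->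
  (forall x, A x -> 0 <= g x)%E -> (forall x, B x -> 0 <= h x)%E ->
  (forall x, A x -> (\int[mu]_(y in A `&` fiber x) g y <=
                    c%:E * \int[mu]_(y in B `&` fiber x) h y)%E) ->
  (\int[mu]_(x in A) g x <= c%:E * \int[mu]_(x in B) h x)%E.
Proof.
move=> mA mB c0 mg mh g0 h0 AB.
rewrite -[in leLHS](bigcup_fibers A) -[in leRHS](bigcup_fibers B).
rewrite !ge0_integral_bigcup//; try exact: trivIset_fibers; rewrite ?bigcup_fibers//.
all: try by move=> j; exact: measurableI.
have gI0 j : (0 <= \int[mu]_(y in A `&` [set x | p x = j]) g y)%E.
  by apply: integral_ge0 => x [/g0].
have hI0 j : (0 <= \int[mu]_(y in B `&` [set x | p x = j]) h y)%E.
  by apply: integral_ge0 => x [/h0].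
rewrite -nneseriesZl//; apply: lee_nneseries => // j _.
have [A0|/set0P[x [Ax /= <-]]] := eqVneq (A `&` [set x | p x = j]) set0; last exact: AB.
by rewrite A0 integral_set0 mule_ge0.
Qed.

End countable_fibers.

Section nonnegative_series.
Context {R : realType}.
Local Open Scope ereal_scope.

Lemma le_term_nneseries (u : (\bar R)^nat) j : (forall k, 0 <= u k) ->
  u j <= \sum_(k <oo) u k.
Proof.
by move=> u0; rewrite (@nneseriesD1 _ _ j)// leeDl// nneseries_ge0.
Qed.

Lemma nneseries_le_partial (u : (\bar R)^nat) M : (forall k, 0 <= u k) ->
  (forall N, \sum_(0 <= k < N) u k <= M) -> \sum_(k <oo) u k <= M.
Proof.
move=> u0 uM; apply: lime_le; last exact: nearW.
by apply: is_cvg_nneseries => k _ _; exact: u0.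
Qed.

Lemma limn_einf_le (u : (\bar R)^nat) M : (forall N, u N <= M) -> limn_einf u <= M.
Proof.
move=> uM; rewrite limn_einf_lim; apply: lime_le; first exact: is_cvg_einfs.
apply: nearW => N; apply: le_trans (uM N).
by apply: ereal_inf_lbound; exists N => /=.
Qed.

End nonnegative_series.

Section integrals.
Context d (T : measurableType d) (R : realType) (mu : {measure set T -> \bar R}).
Implicit Types (A B : set T) (g h : T -> \bar R) (u : T -> R).

(** The integral of a nonnegative function is a supremum over the simple
    functions below it, hence monotone without any measurability. This is what
    allows a maximal function on the right-hand side of the estimates without
    proving that it is measurable. *)
Lemma le_integral_lower A g h :
  (forall x, A x -> 0 <= g x)%E -> (forall x, A x -> g x <= h x)%E ->
  (\int[mu]_(x in A) g x <= \int[mu]_(x in A) h x)%E.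
Proof.
move=> g0 gh.
have h0 x : A x -> (0 <= h x)%E by move=> Ax; apply: le_trans (gh _ Ax); exact: g0.
rewrite !ge0_integralE//.
apply/ereal_sup_le/image_subset => k /= kg x.
by apply: le_trans (kg x) _; rewrite !patchE; case: ifP => // /set_mem; exact: gh.
Qed.

Lemma le_integral_lower_subset A B h :
  (forall x, B x -> 0 <= h x)%E -> A `<=` B ->
  (\int[mu]_(x in A) h x <= \int[mu]_(x in B) h x)%E.
Proof.
move=> h0 AB; rewrite [leLHS]integral_mkcond [leRHS]integral_mkcond.
apply: le_integral_lower => x _; rewrite !patchE.
  by case: ifP => // /set_mem/AB; exact: h0.
case: ifPn => [/set_mem Ax|_]; first by rewrite mem_set//; exact: AB.
by case: ifP => // /set_mem; exact: h0.
Qed.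

Lemma ge0_integral_null_diff A B h :
  measurable A -> measurable B -> A `<=` B -> mu (B `\` A) = 0%E ->
  measurable_fun B h -> (forall x, B x -> 0 <= h x)%E ->
  (\int[mu]_(x in B) h x = \int[mu]_(x in A) h x)%E.
Proof.
move=> mA mB AB BA0 mh h0; have mBA := measurableD mB mA.
by rewrite (ge0_negligible_integral mBA mB mh h0 BA0) setDD setIidr.
Qed.

Lemma integral_weight_ge0 u A : (forall x, 0 <= u x) ->
  (0 <= \int[mu]_(x in A) (u x)%:E)%E.
Proof. by move=> u0; apply: integral_ge0 => x _; rewrite lee_fin. Qed.

Lemma measurable_weight u A : measurable_fun setT u ->
  measurable_fun A (fun x => (u x)%:E).
Proof. by move=> mu_; apply/measurable_EFinP; exact: measurable_funTS. Qed.

Lemma integral_weight_sub u A B : (forall x, 0 <= u x) -> A `<=` B ->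
  (\int[mu]_(x in A) (u x)%:E <= \int[mu]_(x in B) (u x)%:E)%E.
Proof. by move=> u0; apply: le_integral_lower_subset => x _; rewrite lee_fin. Qed.

Lemma integral_weight_setU u A B : measurable_fun setT u ->
  (forall x, 0 <= u x) -> measurable A -> measurable B ->
  (\int[mu]_(x in A `|` B) (u x)%:E <=
   \int[mu]_(x in A) (u x)%:E + \int[mu]_(x in B) (u x)%:E)%E.
Proof.
move=> mu_ u0 mA mB; have AU : A `<=` A `|` B by exact: subsetUl.
rewrite -[X in (\int[mu]_(x in X) _ <= _)%E](setDUK AU).
rewrite ge0_integral_setU//=.
- by apply: leeD => //; apply: integral_weight_sub => // x [[]].
- by apply: measurableD => //; exact: measurableU.
- exact: measurable_weight.
- by move=> x _; rewrite lee_fin.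
- by apply/disj_setPS => x [Ax [_]].
Qed.

Lemma measurable_exceed u A (a c : R) : measurable_fun setT u -> measurable A ->
  measurable [set y | A y /\ (a < `|u y - c|)%R].
Proof.
move=> mu_ mA; rewrite (_ : [set y | _] = A `&` ((fun y => `|u y - c|) @^-1` `]a, +oo[)).
  apply: measurableI => //; rewrite -[X in measurable X]setTI.
  by apply: measurableT_comp => //; exact: measurable_funB.
by apply/seteqP; split => y; rewrite /= in_itv /= andbT.
Qed.

Lemma measurable_below u A (a : R) : measurable_fun setT u -> measurable A ->
  measurable [set y | A y /\ (u y < a)%R].
Proof.
move=> mu_ mA; rewrite (_ : [set y | _] = A `&` (u @^-1` `]-oo, a[)).
  by apply: measurableI => //; rewrite -[X in measurable X]setTI; exact: mu_.
by apply/seteqP; split => y; rewrite /= in_itv.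
Qed.

End integrals.

(** * Lebesgue measure of boxes *)

Section boxes.
Context {R : realType} {n : nat}.
Local Notation Rn := 'rV[R]_n.+1.
Local Notation LRn := (lebesgueRn R n).
Local Notation mu := (@lebesgue R n).
Implicit Types (a b x : Rn) (i j : 'I_n.+1) (c : R).

Definition upd a j c : Rn := \row_i (if i == j then c else a 0 i).

Lemma box_volume_ge0 a b : 0 <= box_volume a b.
Proof. by apply: prodr_ge0 => i _; rewrite le_max lexx orbT. Qed.

Lemma maxr_sub_split (u v c : R) : Num.max (v - u) 0 =
  Num.max (Num.min v c - u) 0 + Num.max (v - Num.max u c) 0.
Proof.
have [vc|cv] := leP v c; have [uc|cu] := leP u c.
all: repeat match goal with |- context [Num.max ?x 0] => case: (leP x 0) => ? end; lra.
Qed.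

(** Cutting a box by a hyperplane preserves the total volume. Empty boxes are
    covered too, because both pieces are truncated at 0 in the same way. *)
Lemma box_volume_split a b j c :
  box_volume a b = box_volume a (upd b j (Num.min (b 0 j) c)) +
                   box_volume (upd a j (Num.max (a 0 j) c)) b.
Proof.
rewrite /box_volume (bigD1 j)//= [X in _ = X + _](bigD1 j)//=.
rewrite [X in _ = _ + X](bigD1 j)//= !mxE eqxx.
under [in RHS]eq_bigr => i /negPf ij do rewrite mxE ij.
under [X in _ = _ + _ * X]eq_bigr => i /negPf ij do rewrite mxE ij.
rewrite -mulrDl; congr (_ * _).
exact: maxr_sub_split.
Qed.

(** Half-spaces satisfy Caratheodory's criterion: cutting every box of a cover
    by the boundary hyperplane yields covers of the two halves of the set, of the
    same total volume. *)
Lemma measurable_le_coord j c : measurable ([set x | x 0 j <= c] : set LRn).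
Proof.
apply: le_caratheodory_measurable => X.
apply: le_ereal_inf_tmp => _ [B BX <-].
pose B1 k := ((B k).1, upd (B k).2 j (Num.min ((B k).2 0 j) c)).
pose B2 k := (upd (B k).1 j (Num.max ((B k).1 0 j) c), (B k).2).
have XB1 : X `&` [set x | x 0 j <= c] `<=` \bigcup_k box (B1 k).1 (B1 k).2.
  move=> x [/BX[k _ Bx] /= xc]; exists k => // i; rewrite mxE; move: (Bx i) => /andP[-> h] /=.
  by case: eqP => // ->; rewrite le_min xc andbT; case/andP : (Bx j).
have XB2 : X `&` ~` [set x | x 0 j <= c] `<=` \bigcup_k box (B2 k).1 (B2 k).2.
  move=> x [/BX[k _ Bx] /= /negP xc]; exists k => // i; rewrite mxE; move: (Bx i) => /andP[h ->] /=.
  rewrite andbT; case: eqP => // ->; rewrite ge_max.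
  by case/andP : (Bx j) => -> _ /=; rewrite ltW// ltNge.
apply: (@le_trans _ _ (\sum_(k <oo) (box_volume (B1 k).1 (B1 k).2)%:E +
    \sum_(k <oo) (box_volume (B2 k).1 (B2 k).2)%:E)%E).
  apply: leeD; apply: ereal_inf_lbound.
    by exists B1.
  by exists B2.
rewrite -nneseriesD//=; do ?by move=> *; rewrite lee_fin box_volume_ge0.
apply: lee_nneseries => k _ *.
  by rewrite adde_ge0// lee_fin box_volume_ge0.
by rewrite [in leRHS](box_volume_split _ _ j c) EFinD.
Qed.

Lemma measurable_coord j : measurable_fun setT (fun x : LRn => x 0 j).
Proof.
apply: (measurability _ (RGenOInfty.measurableE R)).
move=> /= _ [_ [c ->] <-]; rewrite setTI.
rewrite (_ : _ @^-1` _ = ~` [set x : LRn | x 0 j <= c]).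
  exact/measurableC/measurable_le_coord.
by apply/seteqP; split => x /=; rewrite in_itv /= andbT ltNge => /negP.
Qed.

(** Interpolates between the indicator function of a box and its volume: the
    first [m] coordinates have been integrated out. *)
Definition partial_volume (m : nat) a b x : R :=
  \prod_(i < n.+1) (if (i < m)%N then Num.max (b 0 i - a 0 i) 0
                    else \1_(`[a 0 i, b 0 i]) (x 0 i)).

Lemma partial_volume_ge0 m a b x : 0 <= partial_volume m a b x.
Proof.
by apply: prodr_ge0 => i _; case: ifP => _; rewrite ?indicE// le_max lexx orbT.
Qed.

Lemma partial_volume0 a b x : partial_volume 0 a b x = \1_(box a b) x.
Proof.
rewrite /partial_volume [RHS]indicE; case: (boolP (x \in _)) => [/set_mem xab|xab].
  by rewrite big1 // => i _; rewrite indicE mem_set//= in_itv /=; exact: xab.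
suff [i xi] : exists i, x 0 i \notin `[a 0 i, b 0 i].
  by rewrite (bigD1 i)//= indicE memNset ?mul0r//=; exact/negP.
apply/existsP; rewrite -negb_forall; apply: contra xab => /forallP h.
by rewrite inE => i; have := h i; rewrite in_itv.
Qed.

Lemma partial_volume_full a b x : partial_volume n.+1 a b x = box_volume a b.
Proof. by apply: eq_bigr => i _; rewrite ltn_ord. Qed.

Lemma integral_partial_volume m a b x (jm : (m < n.+1)%N) :
  (\int[lebesgue_measure]_(y in [set: R])
     (partial_volume m a b (upd x (Ordinal jm) y))%:E =
   (partial_volume m.+1 a b x)%:E)%E.
Proof.
pose r := \prod_(i < n.+1 | i != Ordinal jm)
  (if (i < m)%N then Num.max (b 0 i - a 0 i) 0 else \1_(`[a 0 i, b 0 i]) (x 0 i)).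
have r0 : 0 <= r.
  by apply: prodr_ge0 => i _; case: ifP => _; rewrite ?indicE// le_max lexx orbT.
set j := Ordinal jm.
have upd_split y : partial_volume m a b (upd x j y) =
    (if (j < m)%N then Num.max (b 0 j - a 0 j) 0 else \1_(`[a 0 j, b 0 j]) y) * r.
  rewrite /partial_volume (bigD1 j)//= mxE eqxx; congr (_ * _).
  by apply: eq_bigr => i /negPf ij; rewrite mxE ij.
under eq_integral do rewrite upd_split ltnn mulrC EFinM.
rewrite ge0_integralZl//=; last first.
  by apply/measurable_EFinP; exact: measurable_indic.
rewrite integral_indic//= setIT.
rewrite /partial_volume (bigD1 j)//= ltnS leqnn.
rewrite (eq_bigr (fun i : 'I_n.+1 => (if (i < m)%N then Num.max (b 0 i - a 0 i) 0
   else \1_(`[a 0 i, b 0 i]) (x 0 i)))); last first.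
  move=> i ij; rewrite ltnS leq_eqVlt; case: eqP => //= im.
  by case/negP: ij; apply/eqP/val_inj.
rewrite -/r mulrC EFinM; congr (_ * _)%E.
rewrite lebesgue_measure_itv/= lte_fin; case: ltP => ab.
  by rewrite max_l // subr_ge0 ltW.
by rewrite max_r// subr_le0.
Qed.

Lemma measurable_partial_volume m a b x j :
  measurable_fun setT (fun y => partial_volume m a b (upd x j y)).
Proof.
apply: measurable_prod => i _.
rewrite [X in measurable_fun _ X](_ : _ = fun y =>
    if (i < m)%N then Num.max (b 0 i - a 0 i) 0
    else \1_(`[a 0 i, b 0 i]) (if i == j then y else x 0 i)); last first.
  by apply/funext => y; rewrite mxE.
by case: (i < m)%N => //; case: (i == j) => //; exact: measurable_indic.
Qed.

(** The volume of a box is at most that of any countable cover by boxes. This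
    is the integral of the pointwise inequality between the indicator of the
    box and the sum of those of the cover; integrating one coordinate at a time
    needs the one-dimensional Lebesgue measure and monotone convergence only. *)
Lemma box_volume_le_cover a b (B : nat -> Rn * Rn) :
  box a b `<=` \bigcup_k box (B k).1 (B k).2 ->
  ((box_volume a b)%:E <= \sum_(k <oo) (box_volume (B k).1 (B k).2)%:E)%E.
Proof.
move=> abB.
suff H m : (m <= n.+1)%N -> forall x, ((partial_volume m a b x)%:E <=
    \sum_(k <oo) (partial_volume m (B k).1 (B k).2 x)%:E)%E.
  have := H n.+1 (leqnn _) 0; rewrite partial_volume_full.
  by under eq_eseriesr do rewrite partial_volume_full.
elim: m => [_ x|m IH mn x].
  rewrite partial_volume0 indicE; case: (boolP (x \in _)) => [/set_mem xab|_]; last first.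
    by apply: nneseries_ge0 => *; rewrite lee_fin partial_volume_ge0.
  have [k _ xk] := abB _ xab.
  rewrite (@nneseriesD1 _ _ k)//; last by move=> *; rewrite lee_fin partial_volume_ge0.
  rewrite partial_volume0 indicE mem_set//= leeDl//.
  by apply: nneseries_ge0 => *; rewrite lee_fin partial_volume_ge0.
rewrite -(integral_partial_volume _ _ _ mn).
under eq_eseriesr do rewrite -(integral_partial_volume _ _ _ mn).
have mpv u v : measurable_fun setT (fun y =>
    (partial_volume m u v (upd x (Ordinal mn) y))%:E).
  by apply/measurable_EFinP; exact: measurable_partial_volume.
rewrite -integral_nneseries//=; first last.
- by move=> k y _; rewrite lee_fin partial_volume_ge0.
- by move=> k; exact: mpv.
apply: ge0_le_integral => //=.
- by move=> *; rewrite lee_fin partial_volume_ge0.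
- exact: mpv.
- apply: ge0_emeasurable_sum => [k y _ _|k _]; last exact: mpv.
  by rewrite lee_fin partial_volume_ge0.
- by move=> y _; apply: IH; exact: ltnW.
Qed.

End boxes.

(** * Dyadic grids *)

Section dyadic.
Context {R : realType} {n : nat}.
Local Notation Rn := 'rV[R]_n.+1.
Local Notation LRn := (lebesgueRn R n).
Local Notation mu := (@lebesgue R n).
Implicit Types (a b x y : Rn) (i j : 'I_n.+1) (c l : R).

Lemma measurable_box a b : measurable (box a b : set LRn).
Proof.
rewrite (_ : box a b = \bigcap_(i in [set: 'I_n.+1])
   (((fun x : LRn => x 0 i) @^-1` `[a 0 i, b 0 i]))); last first.
  apply/seteqP; split => x h i; first by move=> _; rewrite /= in_itv /=; exact: h.
  by have := h i I; rewrite /= in_itv.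
apply: fin_bigcap_measurable => // i _.
by rewrite -[X in measurable X]setTI; exact: measurable_coord.
Qed.

Lemma lebesgue_box a b : mu (box a b) = (box_volume a b)%:E.
Proof.
apply/eqP; rewrite eq_le; apply/andP; split; last first.
  by apply: le_ereal_inf_tmp => _ [B abB <-]; exact: box_volume_le_cover.
have v0 : box_volume (0 : Rn) 0 = 0.
  by rewrite /box_volume big_ord_recl !mxE subrr maxxx mul0r.
apply: ereal_inf_lbound.
exists (fun k => if k == 0%N then (a, b) else (0, 0)).
  by move=> x xab; exists 0%N.
rewrite (@nneseriesD1 _ _ 0%N)//= ?eseries0 ?adde0//.
  by case => [//|k] _ _ /=; rewrite v0.
by move=> k _; rewrite lee_fin box_volume_ge0.
Qed.

Lemma lebesgue_cube a l : 0 <= l ->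
  mu (box a (a + const_mx l)) = (l ^+ n.+1)%:E.
Proof.
move=> l0; rewrite lebesgue_box /box_volume; congr EFin.
under eq_bigr => i _ do rewrite !mxE addrAC subrr add0r max_l//.
by rewrite prodr_const card_ord.
Qed.

(** The grid of level [k] generated by the cube of corner [a] and side [l].
    Cells are half-open, so that each level is a partition of the whole space;
    they are named by their points. *)
Definition side l k : R := l / 2 ^+ k.

Lemma side_gt0 l k : 0 < l -> 0 < side l k.
Proof. by move=> l0; rewrite divr_gt0// exprn_gt0. Qed.

Lemma sideS l k : side l k = 2 * side l k.+1.
Proof. by rewrite /side exprS; field; rewrite expf_neq0. Qed.

Definition dyadic_index a l k x : 'rV[int]_n.+1 :=
  \row_i Num.floor ((x 0 i - a 0 i) / side l k).

Definition dyadic_corner a l k x : Rn :=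
  \row_i (a 0 i + side l k * (dyadic_index a l k x 0 i)%:~R).

Definition dyadic_cell a l k x : set LRn :=
  [set y | dyadic_index a l k y = dyadic_index a l k x].

Definition dyadic_cube a l k x : set LRn :=
  box (dyadic_corner a l k x) (dyadic_corner a l k x + const_mx (side l k)).

Section fixed_grid.
Context (a : Rn) (l : R) (l0 : 0 < l).

Lemma dyadic_index_eqP k x y : reflect
  (forall i, dyadic_corner a l k x 0 i <= y 0 i < dyadic_corner a l k x 0 i + side l k)
  (dyadic_index a l k y == dyadic_index a l k x).
Proof.
have h0 := side_gt0 k l0.
have E i : (dyadic_corner a l k x 0 i <= y 0 i < dyadic_corner a l k x 0 i + side l k) =
  (dyadic_index a l k y 0 i == dyadic_index a l k x 0 i).
  rewrite !mxE floor_eq intrD; set m := (Num.floor _)%:~R.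
  rewrite ler_pdivlMr// ltr_pdivrMr// mulrDl mul1r [m * _]mulrC.
  by apply/idP/idP; lra.
apply: (iffP eqP) => [xy i|h]; first by rewrite E xy.
by apply/rowP => i; apply/eqP; rewrite -E.
Qed.

Lemma mem_dyadic_cell k x y : dyadic_cell a l k x y <->
  (forall i, dyadic_corner a l k x 0 i <= y 0 i < dyadic_corner a l k x 0 i + side l k).
Proof.
by split => [xy|xy]; [apply/dyadic_index_eqP/eqP | apply/eqP/dyadic_index_eqP].
Qed.

Lemma dyadic_cell_subcube k x : dyadic_cell a l k x `<=` dyadic_cube a l k x.
Proof.
move=> y /mem_dyadic_cell h i; rewrite !mxE; have := h i; rewrite !mxE => /andP[-> /ltW]//=.
Qed.

Lemma measurable_dyadic_fiber k (q : 'rV[int]_n.+1) :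
  measurable ([set x | dyadic_index a l k x = q] : set LRn).
Proof.
have h0 := side_gt0 k l0.
rewrite (_ : [set _ | _] = \bigcap_(i in [set: 'I_n.+1])
  ((fun x : LRn => x 0 i) @^-1` [set` `[a 0 i + side l k * (q 0 i)%:~R,
     a 0 i + side l k * (q 0 i)%:~R + side l k[])).
  apply: fin_bigcap_measurable => // i _.
  by rewrite -[X in measurable X]setTI; exact: measurable_coord.
have E x i : (dyadic_index a l k x 0 i == q 0 i) =
  (x 0 i \in `[a 0 i + side l k * (q 0 i)%:~R, a 0 i + side l k * (q 0 i)%:~R + side l k[).
  rewrite !mxE floor_eq intrD in_itv /=.
  rewrite ler_pdivlMr// ltr_pdivrMr// mulrDl mul1r [_%:~R * _]mulrC.
  by apply/idP/idP; lra.
apply/seteqP; split => [x xq i _|x h]; first by rewrite /= -E xq.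
by apply/rowP => i; apply/eqP; rewrite E; exact: (h i I).
Qed.

Lemma measurable_dyadic_cell k x : measurable (dyadic_cell a l k x).
Proof. exact: measurable_dyadic_fiber. Qed.

Lemma dyadic_indexS k x i :
  dyadic_index a l k x 0 i = (dyadic_index a l k.+1 x 0%R i %/ 2)%Z.
Proof.
have h0 := side_gt0 k.+1 l0.
rewrite !mxE; apply/eqP; rewrite floor_eq.
have /andP := floor_itv ((x 0 i - a 0 i) / side l k.+1).
have -> : (x 0 i - a 0 i) / side l k = (x 0 i - a 0 i) / side l k.+1 / 2.
  by rewrite (sideS l k); field; rewrite gt_eqF.
set z := _ / side l k.+1; set m := Num.floor _ => -[h1 h2].
have := divz_eq m 2; set d := (m %/ 2)%Z => md.
move: md (ltz_pmod m (isT : (0 : int) < 2)) (modz_ge0 m (isT : (2 : int) != 0)).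
move: (m %% 2)%Z => r md r2 r0.
have {}r0 : 0 <= (r%:~R : R) by rewrite ler0z.
have {r2} : (r%:~R : R) <= 1 by rewrite lerz1 -ltzD1; exact: r2.
by move: h1 h2; rewrite md !intrD !intrM => h1 h2 r1; apply/andP; split; lra.
Qed.

Lemma dyadic_nested k x y : dyadic_index a l k.+1 x = dyadic_index a l k.+1 y ->
  dyadic_index a l k x = dyadic_index a l k y.
Proof. by move=> xy; apply/rowP => i; rewrite dyadic_indexS [RHS]dyadic_indexS xy. Qed.

Lemma dyadic_cornerS k x i :
  dyadic_corner a l k x 0 i <= dyadic_corner a l k.+1 x 0 i /\
  dyadic_corner a l k.+1 x 0 i + side l k.+1 <= dyadic_corner a l k x 0 i + side l k.
Proof.
have h0 := side_gt0 k.+1 l0.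
rewrite [dyadic_corner a l k _ _ _]mxE [dyadic_corner a l k.+1 _ _ _]mxE dyadic_indexS.
set m := dyadic_index a l k.+1 x 0 i.
have := divz_eq m 2; set d := (m %/ 2)%Z => md.
move: md (ltz_pmod m (isT : (0 : int) < 2)) (modz_ge0 m (isT : (2 : int) != 0)).
move: (m %% 2)%Z => r md r2 r0.
have {}r0 : 0 <= (r%:~R : R) by rewrite ler0z.
have {r2} : (r%:~R : R) <= 1 by rewrite lerz1 -ltzD1; exact: r2.
rewrite md !intrD !intrM (sideS l k) => r1.
split; nra.
Qed.

End fixed_grid.
End dyadic.

Section dyadic_measure.
Context {R : realType} {n : nat}.
Local Notation Rn := 'rV[R]_n.+1.
Local Notation LRn := (lebesgueRn R n).
Local Notation mu := (@lebesgue R n).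
Implicit Types (u v x y : Rn) (i j : 'I_n.+1) (c : R).
Context (a : Rn) (l : R) (l0 : 0 < l).

Lemma measurable_dyadic_cube k x : measurable (dyadic_cube a l k x : set LRn).
Proof. exact: measurable_box. Qed.

Lemma lebesgue_dyadic_cube k x :
  mu (dyadic_cube a l k x) = (side l k ^+ n.+1)%:E.
Proof. by rewrite lebesgue_cube// ltW// side_gt0. Qed.

Lemma lebesgue_face u v i : mu (box (upd u i (v 0 i)) v) = 0%E.
Proof.
by rewrite lebesgue_box /box_volume (bigD1 i)//= mxE eqxx subrr maxxx mul0r.
Qed.

(** The closed cube exceeds the half-open cell by upper faces, which are boxes
    of volume 0. *)
Lemma negligible_cube_cell k x :
  mu.-negligible (dyadic_cube a l k x `\` dyadic_cell a l k x).
Proof.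
set u := dyadic_corner a l k x; pose v := u + const_mx (side l k).
apply: (@negligibleS _ _ _ mu (\bigcup_j box (upd u (inord j) (v 0 (inord j))) v)).
  move=> y [xy nxy].
  have [i yi] : exists i, v 0 i <= y 0 i.
    apply: contrapT => /forallNP h; apply: nxy; apply/mem_dyadic_cell => // i.
    have /andP[-> _] := xy i; have /negP := h i.
    by rewrite -ltNge !mxE.
  exists i => // j; rewrite inord_val !mxE.
  by have := xy j; rewrite !mxE; case: eqP => // -> /andP[_ ->]; rewrite andbT; move: yi; rewrite !mxE.
apply: negligible_bigcup => j.
apply/negligibleP; first exact: measurable_box.
exact: lebesgue_face.
Qed.

Lemma lebesgue_dyadic_cell k x : mu (dyadic_cell a l k x) = (side l k ^+ n.+1)%:E.
Proof.
rewrite -(lebesgue_dyadic_cube k x).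
have sub := @dyadic_cell_subcube R n a l l0 k x.
have mC := measurable_dyadic_cube k x; have mD := measurable_dyadic_cell a l0 k x.
rewrite -[in RHS](setDUK sub) measureU0//; first exact: measurableD.
by apply: measure_negligible; [exact: measurableD|exact: negligible_cube_cell].
Qed.

(** Numbering of the cells of a level, turning the grid into the fibers of a
    function with values in [nat]. *)
Definition dyadic_code k (x : LRn) : nat := pickle (dyadic_index a l k x).

Lemma dyadic_code_fiber k x :
  [set y | dyadic_code k y = dyadic_code k x] = dyadic_cell a l k x.
Proof.
by apply/seteqP; split => y /=; [move=> /(pcan_inj pickleK)|rewrite /dyadic_code => ->].
Qed.

Lemma measurable_dyadic_code k (j : nat) : measurable ([set x | dyadic_code k x = j] : set LRn).
Proof.
have [->|/set0P[x /= <-]] := eqVneq [set x | dyadic_code k x = j] set0 => //.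
rewrite dyadic_code_fiber; exact: measurable_dyadic_cell.
Qed.

Lemma dyadic_cell_thin k x y i : dyadic_cell a l k x y ->
  x 0 i - side l k <= y 0 i <= x 0 i + side l k.
Proof.
have xx : dyadic_cell a l k x x by [].
move=> /(mem_dyadic_cell a l0) /(_ i) yx.
by move: xx => /(mem_dyadic_cell a l0) /(_ i); lra.
Qed.

Lemma side_small e : 0 < e -> exists k0, forall k, (k0 <= k)%N -> side l k < e.
Proof.
move=> e0.
have e1 : 0 < e / l by rewrite divr_gt0.
have [k0 _ h] := near_infty_natSinv_expn_lt (PosNum e1).
exists k0 => k /h /=; rewrite /side => h1.
by rewrite mulrC -ltr_pdivlMr// -div1r.
Qed.

Lemma cvg_lebesgue_fattened_box u v :
  mu (box (u - const_mx (side l k)) (v + const_mx (side l k))) @[k --> \oo]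
  --> mu (box u v).
Proof.
pose F k : set LRn := box (u - const_mx (side l k)) (v + const_mx (side l k)).
have -> : mu (box u v) = mu (\bigcap_k F k).
  congr (mu _); apply/seteqP; split => [x uvx k _ i|x h i].
    have := uvx i; have := side_gt0 k l0; rewrite !mxE; lra.
  apply/andP; split; apply/ler_addgt0Pr => e /side_small[k0 /(_ _ (leqnn _)) ke].
    by have := h k0 I i; rewrite !mxE; lra.
  by have := h k0 I i; rewrite !mxE; lra.
apply: nonincreasing_cvg_mu.
- by rewrite lebesgue_box ltry.
- by move=> k; exact: measurable_box.
- by apply: bigcap_measurable => // k _; exact: measurable_box.
- apply/nonincreasing_seqP => k; apply/subsetPset => x h i; have := h i.
  by have := sideS l k; have := side_gt0 k.+1 l0; rewrite !mxE; lra.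
Qed.

(** A weak form of Lebesgue's density theorem: a set that fills at most the
    proportion [theta] of every small cell around each of its points is null.
    Covering a box by the cells that meet it shows that the set fills at most
    the proportion [theta] of every box; hence its outer measure, an infimum
    over covers by boxes, is at most [theta] times itself. *)
Lemma dyadic_density (A : set LRn) (theta : R) (k0 : nat) :
  measurable A -> (mu A < +oo)%E -> 0 < theta < 1 ->
  (forall k x, (k0 <= k)%N -> A x ->
     mu (A `&` dyadic_cell a l k x) <= theta%:E * mu (dyadic_cell a l k x))%E ->
  mu A = 0%E.
Proof.
move=> mA Afin /andP[th0 th1] Ath.
have th_ge0 := ltW th0.
have boxE u v : (mu (A `&` box u v) <= theta%:E * (box_volume u v)%:E)%E.
  rewrite -lebesgue_box.
  have /cvgeZl-/(_ theta%:E isT) cvF := (@cvg_lebesgue_fattened_box u v).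
  apply: (cvge_to_ge cvF).
  exists k0 => // k k0k; rewrite -[X in (_ <= X)%E]/(theta%:E * mu _)%E.
  apply: (@le_measure_fibers _ _ _ mu (dyadic_code k)) => //.
  - by move=> j; exact: measurable_dyadic_code.
  - by apply: measurableI => //; exact: measurable_box.
  - exact: measurable_box.
  move=> x [Ax uvx]; rewrite dyadic_code_fiber.
  rewrite [X in (_ <= _ * mu X)%E](_ : _ = dyadic_cell a l k x); last first.
    apply/seteqP; split => [y []//|y xy]; split => // i.
    by have := dyadic_cell_thin i xy; have := uvx i; rewrite !mxE; lra.
  apply: le_trans (Ath k x k0k Ax).
  apply: le_measure; rewrite ?inE.
  - by do 2?apply: measurableI => //; [exact: measurable_box|exact: measurable_dyadic_cell].
  - by apply: measurableI => //; exact: measurable_dyadic_cell.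
  - by move=> y [[]].
suff : ((theta^-1)%:E * mu A <= mu A)%E.
  have /fineK <- : mu A \is a fin_num by rewrite ge0_fin_numE.
  have : 0 <= fine (mu A) by exact: fine_ge0.
  rewrite -EFinM lee_fin; set m := fine _ => m0.
  have : 1 < theta^-1 by rewrite invf_gt1.
  by move=> *; congr EFin; nra.
apply: le_ereal_inf_tmp => _ [B AB <-].
rewrite lee_pdivrMl// -nneseriesZl//; last first.
  by move=> *; rewrite lee_fin box_volume_ge0.
apply: (@le_trans _ _ (\sum_(k <oo) mu (A `&` box (B k).1 (B k).2))%E).
  apply: measure_sigma_subadditive => //.
    by move=> k; apply: measurableI => //; exact: measurable_box.
  by move=> x Ax; have [k _ xk] := AB _ Ax; exists k.
apply: lee_nneseries => // k _; exact: boxE.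
Qed.

End dyadic_measure.

(** * Medians and oscillations *)

Section medians.
Context {R : realType} {n : nat}.
Local Notation Rn := 'rV[R]_n.+1.
Local Notation LRn := (lebesgueRn R n).
Local Notation mu := (@lebesgue R n).
Implicit Types (P Q : set LRn) (a c e : R).
Context (f : LRn -> R) (s t : R).
Hypothesis mf : measurable_fun setT f.
Hypothesis s_gt0 : 0 < s.
Hypothesis s_le_t : s <= t.
Hypothesis st_lt1 : s + t < 1.

Lemma oscillation_ge0 Q : (0 <= oscillation s f Q)%E.
Proof.
apply: le_ereal_inf_tmp => _ [c _ <-].
by apply: le_ereal_inf_tmp => _ [a [a0 _] <-]; rewrite lee_fin.
Qed.

Lemma oscillation_lt Q e : (oscillation s f Q < e%:E)%E ->
  exists c a, [/\ 0 <= a, a < e &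
    (mu [set y | Q y /\ (a < `|f y - c|)%R] < s%:E * mu Q)%E].
Proof.
move=> /ereal_inf_lt[_ [c _ <-]] /ereal_inf_lt[_ [a [a0 ha] <-]].
by rewrite lte_fin => ae; exists c, a.
Qed.

Section one_set.
Context (Q : set LRn) (mQ : measurable Q).
Hypotheses (Q_fin : (mu Q < +oo)%E) (Q_gt0 : (0 < mu Q)%E).

(** If [f] is within [a] of [c] except on less than a fraction [s] of [Q], then
    less than [s <= t] of [Q] lies below [c - a] and more than [1 - s > t] of it
    lies below any level above [c + a], which traps the median. *)
Lemma median_near c a :
  (mu [set y | Q y /\ (a < `|f y - c|)%R] < s%:E * mu Q)%E -> `|median f t Q - c| <= a.
Proof.
move=> far.
have finQ : mu Q \is a fin_num by rewrite ge0_fin_numE.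
set S := [set M | (mu [set y | Q y /\ (f y < M)%R] <= t%:E * mu Q)%E].
have Sl : S (c - a).
  apply: (@le_trans _ _ (s%:E * mu Q)%E); last first.
    by apply: lee_wpmul2r => //; rewrite lee_fin.
  apply: le_trans (ltW far); apply: le_measure; rewrite ?inE.
  - exact: measurable_below.
  - exact: measurable_exceed.
  - move=> y /= [Qy h]; split => //; rewrite distrC.
    by apply: lt_le_trans (ler_norm _); rewrite ltrBrDl -ltrBrDr.
have Su : ubound S (c + a).
  move=> M SM; rewrite leNgt; apply/negP => cM.
  have : (mu Q < t%:E * mu Q + s%:E * mu Q)%E.
    apply: (@le_lt_trans _ _ (mu [set y | Q y /\ (f y < M)%R] +
        mu [set y | Q y /\ (a < `|f y - c|)%R])%E).
      have mb := measurable_below M mf mQ; have me := measurable_exceed a c mf mQ.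
      apply: le_trans (measureU2 mu mb me).
      apply: le_measure; rewrite ?inE//; first exact: measurableU.
      move=> y Qy; have [fM|Mf] := ltP (f y) M; first by left.
      right; split => //; apply: lt_le_trans (ler_norm _).
      by rewrite ltrBrDl; exact: lt_le_trans Mf.
    apply: lee_ltD => //.
    rewrite ge0_fin_numE//; apply: le_lt_trans SM _.
    by rewrite -(fineK finQ) -EFinM ltry.
  move: Q_gt0; rewrite -(fineK finQ) -!EFinM -EFinD !lte_fin => q0.
  have h1 : 0 < 1 - s - t by move: st_lt1; lra.
  by have := mulr_gt0 h1 q0; lra.
have hi : median f t Q <= c + a by apply: ge_sup => //; exists (c - a).
have lo : c - a <= median f t Q by apply: ub_le_sup => //; exists (c + a).
by rewrite ler_distl lo hi.
Qed.

(** The median can replace the almost optimal constants in the definition of the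
    oscillation at the cost of a factor 2. The infimum need not be attained; it
    is approached along [lam + 1 / (k + 1)] and the exceptional sets increase to
    the one of level [2 * lam]. *)
Lemma median_center lam : (oscillation s f Q <= lam%:E)%E ->
  (mu [set y | Q y /\ (2 * lam < `|f y - median f t Q|)%R] <= s%:E * mu Q)%E.
Proof.
move=> osc.
pose F (k : nat) := [set y | Q y /\ (2 * (lam + k.+1%:R^-1) < `|f y - median f t Q|)%R].
have -> : [set y | Q y /\ (2 * lam < `|f y - median f t Q|)%R] = \bigcup_k F k.
  apply/seteqP; split => [y [Qy h]|y [k _ [Qy h]]]; last first.
    by split => //; apply: le_lt_trans h; rewrite ler_pM2l// lerDl invr_ge0.
  have e0 : 0 < `|f y - median f t Q| / 2 - lam by lra.
  have [k _ /(_ k (leqnn _)) /= hk] := near_infty_natSinv_lt (PosNum e0).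
  by exists k => //; split => //; move: hk; set z := _^-1 => hk; lra.
have mF k : measurable (F k) by exact: measurable_exceed.
have cvF : mu \o F @ \oo --> mu (\bigcup_k F k).
  apply: nondecreasing_cvg_mu => //; first exact: bigcup_measurable.
  move=> j k jk; apply/subsetPset => y [Qy h]; split => //; apply: le_lt_trans h.
  by rewrite ler_pM2l// lerD2l lef_pV2 ?posrE// ler_nat.
apply: (cvge_to_le cvF); apply: nearW => k /=.
have [|c [a [a0 ak ca]]] := @oscillation_lt Q (lam + k.+1%:R^-1).
  by apply: le_lt_trans osc _; rewrite lte_fin ltrDl invr_gt0.
apply: le_trans (ltW ca); apply: le_measure; rewrite ?inE//.
  exact: measurable_exceed.
move=> y [Qy h]; split => //; have mc := median_near ca.
by move: h ak; set z := _^-1 => h ak; have := ler_distD c (f y) (median f t Q); rewrite [`|c - _|]distrC; lra.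
Qed.

End one_set.

(** When the exceptional sets of two nested sets cannot cover the smaller one,
    some point of it has a value close to both medians. *)
Lemma median_nested P Q lam : measurable P -> measurable Q -> Q `<=` P ->
  (mu P < +oo)%E -> (0 < mu Q)%E -> (s%:E * mu Q + s%:E * mu P < mu Q)%E ->
  (oscillation s f P <= lam%:E)%E -> (oscillation s f Q <= lam%:E)%E ->
  `|median f t Q - median f t P| <= 4 * lam.
Proof.
move=> mP mQ QP Pfin Q0 sPQ oP oQ.
have QleP : (mu Q <= mu P)%E by apply: le_measure; rewrite ?inE.
have Qfin : (mu Q < +oo)%E by exact: le_lt_trans Pfin.
have P0 : (0 < mu P)%E by exact: lt_le_trans QleP.
have hP := median_center mP Pfin P0 oP; have hQ := median_center mQ Qfin Q0 oQ.
have [y [Qy yP yQ]] : exists y, [/\ Q y, `|f y - median f t P| <= 2 * lam &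
    `|f y - median f t Q| <= 2 * lam].
  apply: contrapT => /forallNP h.
  move: sPQ; rewrite ltNge => /negP; apply.
  have meP := measurable_exceed (2 * lam) (median f t P) mf mP.
  have meQ := measurable_exceed (2 * lam) (median f t Q) mf mQ.
  apply: le_trans (leeD hQ hP); apply: le_trans (measureU2 mu meQ meP).
  have mU := measurableU _ _ meQ meP.
  apply: (le_measure mu (mem_set mQ) (mem_set mU)).
  move=> y Qy; have := h y => /not_and3P[//|/negP|/negP]; rewrite -ltNge => hy.
    by right; split => //; exact: QP.
  by left.
have := ler_distD (f y) (median f t Q) (median f t P).
by rewrite [`|median _ _ Q - f y|]distrC; lra.
Qed.

(** Supremum of the oscillations over the cubes between [Q] and [Q0]. Unlike the
    infimum over [Q] of the sharp maximal function, which it minorizes, it is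
    always finite, because these cubes have at least the measure of [Q]. *)
Definition cube_oscillation Q0 Q : \bar R :=
  ereal_sup [set oscillation s f P | P in [set P | [/\ cube P, P `<=` Q0 & Q `<=` P]]].

Definition sup_oscillation Q0 Q : R := fine (cube_oscillation Q0 Q).

Lemma cube_measurable Q : cube Q -> measurable Q.
Proof. by move=> [a [l [_ ->]]]; exact: measurable_box. Qed.

Lemma cube_measure Q : cube Q -> (0 < mu Q < +oo)%E.
Proof.
by move=> [a [l [l0 ->]]]; rewrite lebesgue_cube ?ltW// lte_fin exprn_gt0//= ltry.
Qed.

Lemma cube_oscillation_fin Q0 Q : cube Q0 -> cube Q -> Q `<=` Q0 ->
  cube_oscillation Q0 Q \is a fin_num.
Proof.
move=> cQ0 cQ QQ0.
have mQ0 := cube_measurable cQ0; have /andP[_ Q0fin] := cube_measure cQ0.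
have /andP[Q_gt0 Q_fin] := cube_measure cQ.
(* A level exceeded by |f| on less than a fraction s of Q, the smallest of the
   cubes under consideration: the constant 0 then witnesses oscillation <= A. *)
have [A A0 hA] : exists2 A, 0 <= A &
    (mu [set y | Q0 y /\ (A < `|f y - 0|)%R] < s%:E * mu Q)%E.
  pose F (k : nat) := [set y | Q0 y /\ (k%:R < `|f y - 0|)%R].
  have mF k : measurable (F k) by exact: measurable_exceed.
  have cvF : mu \o F @ \oo --> mu (\bigcap_k F k).
    apply: nonincreasing_cvg_mu => //.
    - by apply: le_lt_trans Q0fin; apply: le_measure; rewrite ?inE// => y [].
    - exact: bigcapT_measurable.
    - move=> j k jk; apply/subsetPset => y [Qy h]; split => //.
      by apply: le_lt_trans h; rewrite ler_nat.
  rewrite (_ : \bigcap_k F k = set0) ?measure0 in cvF; last first.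
    rewrite -subset0 => y h.
    have := h (Num.truncn `|f y - 0|).+1 I; rewrite /F /= => -[_].
    by have := truncnS_gt `|f y - 0|; lra.
  have pos : (0 < s%:E * mu Q)%E by rewrite mule_gt0.
  have [k _ /(_ k (leqnn _)) hk] : \forall k \near \oo, (mu (F k) < s%:E * mu Q)%E.
    have := cvF; move=> /(_ [set z | (z < s%:E * mu Q)%E]); apply.
    by apply: open_nbhs_nbhs; split => //; exact: open_ereal_lt_ereal.
  by exists k%:R.
rewrite fin_numElt; apply/andP; split.
  apply: (@lt_le_trans _ _ 0%E) => //; apply: le_trans (oscillation_ge0 Q0) _.
  by apply: ereal_sup_ubound; exists Q0 => //; split.
apply: (@le_lt_trans _ _ A%:E); last by rewrite ltry.
apply: ge_ereal_sup => _ [P [cP PQ0 QP] <-].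
apply: (@le_trans _ _ (ereal_inf [set a%:E | a in
      [set a : R | 0 <= a /\
        (mu [set y | P y /\ (a < `|f y - 0|)%R] < s%:E * mu P)%E]])).
  by apply: ereal_inf_lbound; exists 0.
apply: ereal_inf_lbound; exists A => //; split => //.
have mP := cube_measurable cP.
apply: (@le_lt_trans _ _ (mu [set y | Q0 y /\ (A < `|f y - 0|)%R])).
  apply: le_measure; rewrite ?inE//; try exact: measurable_exceed.
  by move=> y [/PQ0].
apply: (lt_le_trans hA); apply: lee_wpmul2l; first by rewrite lee_fin ltW.
by apply: le_measure; rewrite ?inE//; exact: cube_measurable.
Qed.

Lemma oscillation_le_sup Q0 P Q : cube Q0 -> cube P -> cube Q ->
  Q `<=` P -> P `<=` Q0 -> (oscillation s f P <= (sup_oscillation Q0 Q)%:E)%E.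
Proof.
move=> cQ0 cP cQ QP PQ0; rewrite fineK; last first.
  by apply: cube_oscillation_fin => //; exact: subset_trans PQ0.
by apply: ereal_sup_ubound; exists P.
Qed.

Lemma sup_oscillation_homo Q0 P Q : cube Q0 -> cube P -> cube Q ->
  Q `<=` P -> P `<=` Q0 -> sup_oscillation Q0 P <= sup_oscillation Q0 Q.
Proof.
move=> cQ0 cP cQ QP PQ0; apply: fine_le.
- exact: cube_oscillation_fin.
- by apply: cube_oscillation_fin => //; exact: subset_trans PQ0.
apply: ereal_sup_le => _ [P' [cP' P'Q0 PP'] <-].
by exists P' => //; split => //; exact: subset_trans PP'.
Qed.

Lemma sup_oscillation_ge0 Q0 Q : cube Q0 -> cube Q -> Q `<=` Q0 ->
  0 <= sup_oscillation Q0 Q.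
Proof.
move=> cQ0 cQ QQ0; rewrite -lee_fin; apply: le_trans (oscillation_ge0 Q0) _.
exact: oscillation_le_sup.
Qed.

Lemma sup_oscillation_le_sharp Q0 Q x : cube Q0 -> cube Q -> Q `<=` Q0 -> Q x ->
  ((sup_oscillation Q0 Q)%:E <= sharp_maximal s Q0 f x)%E.
Proof.
move=> cQ0 cQ QQ0 Qx; rewrite fineK; last exact: cube_oscillation_fin.
apply: ereal_sup_le => _ [P [cP PQ0 QP] <-]; exists P => //; split => //; exact: QP.
Qed.

End medians.

(** * Medians of a cube and of its double *)

Lemma expr1Dx_le {R : realFieldType} (x : R) N : 0 <= x <= 1 ->
  (1 + x) ^+ N <= 1 + 2 ^+ N * x.
Proof.
move=> /andP[x0 x1].
suff : (1 + x) ^+ N <= 1 + (2 ^+ N - 1) * x by move=> h; apply: le_trans h _; lra.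
elim: N => [|N IH]; first by rewrite !expr0 subrr mul0r addr0.
have t0 : 1 <= 2 ^+ N :> R by rewrite exprn_ege1// ler1n.
rewrite exprS; set P := (1 + x) ^+ N in IH *; rewrite exprS; set T := 2 ^+ N in IH t0 *.
have x10 : 0 <= 1 + x by lra.
have h1 := ler_wpM2l x10 IH.
have h2 : 0 <= (T - 1) * (x * (1 - x)) by rewrite !mulr_ge0 ?subr_ge0.
by lra.
Qed.

Lemma powR_le_one {R : realType} (x b : R) : 0 <= x <= 1 -> 0 <= b -> x `^ b <= 1.
Proof.
move=> /andP[x0 x1] b0; have := @ge0_ler_powR _ b b0 x 1.
by rewrite powR1 !nnegrE; apply.
Qed.

(** Since [s < 1/2], dilating a cube by the factor [1 + 1 / M] with [M] large
    keeps the exceptional fractions [s] of both cubes from covering the small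
    one. *)
Lemma small_dilation {R : realType} (s : R) N : 0 < s -> s < 2^-1 ->
  exists2 M : nat, (0 < M)%N & s * (1 + (1 + M%:R^-1) ^+ N) < 1.
Proof.
move=> s0 s2.
have e0 : 0 < (1 - 2 * s) / (s * 2 ^+ N).
  by rewrite divr_gt0 ?mulr_gt0 ?exprn_gt0//; lra.
have [k _ /(_ k (leqnn _)) /= hk] := near_infty_natSinv_lt (PosNum e0).
exists k.+1 => //; set z := _^-1 in hk *.
have z01 : 0 <= z <= 1 by rewrite invr_ge0 ler0n/= invf_le1// ler1n.
have := expr1Dx_le N z01; move: hk; rewrite ltr_pdivlMr ?mulr_gt0 ?exprn_gt0//.
set E := (1 + z) ^+ N; set T := 2 ^+ N => h1 h2.
have : s * E <= s * (1 + T * z) by rewrite ler_pM2l.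
by nra.
Qed.

Section doubling_chain.
Context {R : realType} {n : nat}.
Local Notation Rn := 'rV[R]_n.+1.
Local Notation LRn := (lebesgueRn R n).
Local Notation mu := (@lebesgue R n).
Context (f : LRn -> R) (s t : R).
Hypothesis mf : measurable_fun setT f.
Hypothesis s_gt0 : 0 < s.
Hypothesis s_le_t : s <= t.
Hypothesis st_lt1 : s + t < 1.

(** Passing from a cube to one of twice its side in one step would need [s] to
    be small depending on the dimension. Instead, [M] steps interpolate linearly
    between the two cubes; each dilates by a factor at most [1 + 1 / M], so that
    [median_nested] applies to consecutive cubes. *)
Lemma median_double_cube (Q0 : set LRn) (a b : Rn) (l : R) (M : nat) :
  (0 < M)%N -> s * (1 + (1 + M%:R^-1) ^+ n.+1) < 1 -> 0 < l -> cube Q0 ->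
  (forall i, b 0 i <= a 0 i /\ a 0 i + l <= b 0 i + 2 * l) ->
  box b (b + const_mx (2 * l)) `<=` Q0 ->
  `|median f t (box a (a + const_mx l)) - median f t (box b (b + const_mx (2 * l)))| <=
   4 * M%:R * sup_oscillation f s Q0 (box a (a + const_mx l)).
Proof.
move=> M0 sM l0 cQ0 ab bQ0.
have MR0 : 0 < M%:R :> R by rewrite ltr0n.
pose th (j : nat) : R := j%:R / M%:R.
have thS j : th j.+1 = th j + M%:R^-1 by rewrite /th -natr1 mulrDl mul1r.
have th_ge0 j : 0 <= th j by rewrite divr_ge0.
have Minv0 : 0 < M%:R^-1 :> R by rewrite invr_gt0.
pose u (j : nat) : Rn := \row_i (a 0 i + th j * (b 0 i - a 0 i)).
pose Q j : set LRn := box (u j) (u j + const_mx (l * (1 + th j))).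
have side_gt0 j : 0 < l * (1 + th j).
  by rewrite mulr_gt0// ltr_wpDr.
have cQ j : cube (Q j) by exists (u j), (l * (1 + th j)).
have QS j : Q j `<=` Q j.+1.
  move=> x xQ i; have := xQ i; have [h1 h2] := ab i; rewrite !mxE thS.
  move: Minv0; set z := M%:R^-1 => z0.
  have k1 : 0 <= z * (a 0 i - b 0 i) by apply: mulr_ge0; lra.
  have k2 : 0 <= z * (b 0 i + 2 * l - (a 0 i + l)) by apply: mulr_ge0; lra.
  by move=> /andP[? ?]; apply/andP; split; lra.
have Qmono i j : (i <= j)%N -> Q i `<=` Q j.
  by move=> /subnK <-; elim: (j - i)%N => //= e IH; exact: subset_trans (QS _).
have Q_0 : Q 0 = box a (a + const_mx l).
  rewrite /Q (_ : u 0 = a); last by apply/rowP => i; rewrite !mxE /th !mul0r addr0.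
  by rewrite /th mul0r addr0 mulr1.
have Q_M : Q M = box b (b + const_mx (2 * l)).
  rewrite /Q /th divff ?gt_eqF// (_ : u M = b); last first.
    by apply/rowP => i; rewrite !mxE /th divff ?gt_eqF// mul1r addrC subrK.
  by rewrite [l * _]mulrC.
rewrite -Q_0 -Q_M.
set lam := sup_oscillation f s Q0 (Q 0).
suff H j : (j <= M)%N -> `|median f t (Q 0) - median f t (Q j)| <= 4 * j%:R * lam.
  exact: H.
elim: j => [_|j IH jM]; first by rewrite subrr normr0 mulr0 mul0r.
have osc i : (i <= M)%N -> (oscillation s f (Q i) <= lam%:E)%E.
  move=> iM; apply: oscillation_le_sup => //; first exact: Qmono.
  by apply: subset_trans (Qmono _ _ iM) _; rewrite Q_M.
have step : `|median f t (Q j) - median f t (Q j.+1)| <= 4 * lam.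
  have := cube_measure (cQ j); have := cube_measure (cQ j.+1).
  move=> /andP[_ fin] /andP[pos _].
  apply: (@median_nested _ _ f s t) => //; try exact: cube_measurable.
  - rewrite /Q !lebesgue_cube ?(ltW (side_gt0 _))// -!EFinM -EFinD lte_fin.
    have le : (l * (1 + th j.+1)) ^+ n.+1 <=
              (l * (1 + th j)) ^+ n.+1 * (1 + M%:R^-1) ^+ n.+1.
      rewrite -exprMn lerXn2r ?nnegrE ?(ltW (side_gt0 _))//.
        by rewrite mulr_ge0 ?(ltW (side_gt0 _))// addr_ge0// ltW.
      rewrite thS -mulrA ler_pM2l//.
      have : 0 <= th j * M%:R^-1 by rewrite mulr_ge0// ltW.
      by set z := M%:R^-1; lra.
    move: le (exprn_gt0 n.+1 (side_gt0 j)).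
    set A := (l * (1 + th j.+1)) ^+ _; set B := (l * (1 + th j)) ^+ _.
    set C := (1 + _) ^+ _ in sM * => le B0.
    apply: (@le_lt_trans _ _ (B * (s * (1 + C)))); last by rewrite gtr_pMr.
    have := ler_wpM2l (ltW s_gt0) le; lra.
  - exact: osc.
  - by apply: osc; exact: ltnW.
apply: le_trans (ler_distD (median f t (Q j)) _ _) _.
by rewrite -[j.+1%:R]natr1 mulrDr mulr1 mulrDl; exact: lerD (IH (ltnW jM)) step.
Qed.

End doubling_chain.

(** * Weights on cubes *)

Section weights.
Context {R : realType} {n : nat}.
Local Notation Rn := 'rV[R]_n.+1.
Local Notation LRn := (lebesgueRn R n).
Local Notation mu := (@lebesgue R n).
Context (w v : LRn -> R).
Hypotheses (mw : measurable_fun setT w) (mv : measurable_fun setT v).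
Hypotheses (w0 : forall x, 0 <= w x) (v0 : forall x, 0 <= v x).

Context (c1 beta alpha : R).
Hypotheses (c1_gt0 : 0 < c1) (beta_gt0 : 0 < beta) (alpha01 : 0 < alpha < 1).
Hypothesis F : forall Q E : set LRn, cube Q -> measurable E -> E `<=` Q ->
  (mu E <= alpha%:E * mu Q)%E ->
  (\int[mu]_(x in E) (w x)%:E <=
   (c1 * (fine (mu E) / fine (mu Q)) `^ beta)%:E *
   \int[mu]_(x in Q `\` E) (v x)%:E)%E.

Lemma condition_F_ratio (Q E : set LRn) (r : R) : cube Q -> measurable E -> E `<=` Q ->
  0 <= r <= alpha -> (mu E <= r%:E * mu Q)%E ->
  (\int[mu]_(x in E) (w x)%:E <=
   (c1 * r `^ beta)%:E * \int[mu]_(x in Q `\` E) (v x)%:E)%E.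
Proof.
move=> cQ mE EQ /andP[r0 ra] Er.
have /andP[Q_gt0 Q_fin] := cube_measure cQ.
apply: le_trans (F cQ mE EQ _) _.
  by apply: le_trans Er _; apply: lee_wpmul2r => //; rewrite lee_fin.
apply: lee_wpmul2r; first exact: integral_weight_ge0.
rewrite lee_fin ler_pM2l//.
have Qf : mu Q \is a fin_num by rewrite ge0_fin_numE.
have q0 : 0 < fine (mu Q) by rewrite fine_gt0// Q_gt0.
have e0 : 0 <= fine (mu E) by exact: fine_ge0.
apply: ge0_ler_powR; rewrite ?nnegrE ?divr_ge0 ?(ltW beta_gt0) ?(ltW q0)//.
rewrite ler_pdivrMr// -lee_fin EFinM fineK ?(fineK Qf)//.
by rewrite ge0_fin_numE//; apply: le_lt_trans Er _; rewrite -(fineK Qf) ltry.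
Qed.

(** Enlarging [E] to its union with [E'] before applying condition F removes
    [E'] from the right-hand side. *)
Lemma small_piece (Q E E' : set LRn) : cube Q -> measurable E -> E `<=` Q ->
  measurable E' -> E' `<=` Q ->
  (mu E <= (alpha / 2)%:E * mu Q)%E -> (mu E' <= (alpha / 2)%:E * mu Q)%E ->
  (\int[mu]_(x in E) (w x)%:E <= c1%:E * \int[mu]_(x in Q `\` E') (v x)%:E)%E.
Proof.
move=> cQ mE EQ mE' E'Q Ea E'a; have /andP[a0 a1] := alpha01.
have mQ := cube_measurable cQ.
have mU := measurableU _ _ mE mE'.
have UQ : E `|` E' `<=` Q by move=> x [/EQ|/E'Q].
apply: (@le_trans _ _ (\int[mu]_(x in E `|` E') (w x)%:E)%E).
  by apply: integral_weight_sub => //; exact: subsetUl.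
have Ua : (mu (E `|` E') <= alpha%:E * mu Q)%E.
  apply: le_trans (measureU2 mu mE mE') _; apply: le_trans (leeD Ea E'a) _.
  have h2 : 0 <= alpha / 2 by lra.
  by rewrite -ge0_muleDl ?lee_fin// -EFinD -splitr.
apply: le_trans (condition_F_ratio cQ mU UQ _ Ua) _; first by rewrite lexx ltW.
apply: lee_pmul.
- by rewrite lee_fin mulr_ge0 ?powR_ge0// ltW.
- exact: integral_weight_ge0.
- rewrite lee_fin ger_pMr//.
  by apply: powR_le_one; rewrite ?(ltW a0) ?(ltW a1) ?(ltW beta_gt0).
- apply: integral_weight_sub => //.
  by apply: setDS; exact: subsetUr.
Qed.

(** Condition F only concerns small sets; it controls the whole cube after the
    cube has been cut into [N] slabs, each small enough for [small_piece]. *)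
Lemma weight_cube (Q E' : set LRn) (N : nat) : (2 / alpha <= N%:R) -> cube Q ->
  measurable E' -> E' `<=` Q -> (mu E' <= (alpha / 2)%:E * mu Q)%E ->
  (\int[mu]_(x in Q) (w x)%:E <=
   (N.+1%:R * c1)%:E * \int[mu]_(x in Q `\` E') (v x)%:E)%E.
Proof.
move=> Na cQ mE' E'Q E'a; have /andP[a0 a1] := alpha01.
have [a [l [l0 QE]]] := cQ.
have N0 : 0 < N%:R :> R by apply: lt_le_trans Na; rewrite divr_gt0.
pose b (j : nat) : R := a 0 ord0 + l * (j%:R / N%:R).
have bS j : b j.+1 = b j + l / N%:R.
  by rewrite /b -natr1 mulrDl mulrDr mul1r addrA.
pose top (j : nat) : Rn := upd (a + const_mx l) ord0 (b j).
pose slab j : set LRn := box (upd a ord0 (b j)) (top j.+1).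
have slabQ j : (j < N)%N -> slab j `<=` Q.
  move=> jN x xs; rewrite QE => i; have := xs i; rewrite !mxE.
  case: eqP => [->|//]; rewrite /b.
  have h1 : 0 <= l * (j%:R / N%:R) by rewrite mulr_ge0 ?divr_ge0 // ltW.
  have h2 : l * (j.+1%:R / N%:R) <= l.
    by rewrite ger_pMr// ler_pdivrMr// mul1r ler_nat.
  by move: h1 h2; set y := l * _; set z := l * _ => h1 h2 /andP[? ?]; apply/andP; split; lra.
have mslab j : measurable (slab j) by exact: measurable_box.
have slab_measure j : (mu (slab j) <= (alpha / 2)%:E * mu Q)%E.
  rewrite /slab QE lebesgue_cube ?(ltW l0)// lebesgue_box -EFinM lee_fin /box_volume.
  rewrite big_ord_recl !mxE eqxx bS addrAC subrr add0r.
  rewrite (eq_bigr (fun=> l)); last first.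
    by move=> i _; rewrite !mxE /= addrAC subrr add0r max_l// ltW.
  rewrite prodr_const card_ord max_l; last by rewrite divr_ge0 ?(ltW l0) ?(ltW N0).
  rewrite exprS mulrA ler_pM2r ?exprn_gt0//.
  rewrite mulrC ler_pM2r// -invf_div lef_pV2 ?posrE ?divr_gt0//.
set X := (\int[mu]_(x in Q `\` E') (v x)%:E)%E.
have slab_le j : (j < N)%N -> (\int[mu]_(x in slab j) (w x)%:E <= c1%:E * X)%E.
  by move=> jN; apply: small_piece => //; exact: slabQ.
have cX0 : (0 <= c1%:E * X)%E by rewrite mule_ge0 ?integral_weight_ge0// lee_fin ltW.
(* The part of Q below b j: its j slabs count once each; the extra one in j.+1
   pays for the degenerate box obtained for j = 0. *)
have part j : (j <= N)%N ->
    (\int[mu]_(x in box a (top j)) (w x)%:E <= j.+1%:R%:E * (c1%:E * X))%E.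
  elim: j => [_|j IH jN].
    rewrite mul1e; apply: le_trans (slab_le 0%N _); last by rewrite -(ltr_nat R).
    apply: integral_weight_sub => //.
    move=> x xa i; have := xa i; rewrite !mxE; case: eqP => [->|//].
    rewrite bS /b mul0r mulr0 addr0 => /andP[-> h] /=.
    by apply: le_trans h _; rewrite lerDl divr_ge0// ltW.
  apply: (@le_trans _ _ (\int[mu]_(x in box a (top j) `|` slab j) (w x)%:E)%E).
    apply: integral_weight_sub => //.
    move=> x xa; have [xb|bx] := leP (x 0 ord0) (b j); [left|right] => i; have := xa i;
      rewrite !mxE; case: eqP => [->|//] /andP[h1 h2]; first by rewrite h1.
    by rewrite h2 ltW.
  apply: le_trans (integral_weight_setU mu mw w0 (measurable_box _ _) (mslab j)) _.
  rewrite -[j.+2%:R]natr1 EFinD ge0_muleDl ?lee_fin// mul1e.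
  by apply: leeD; [apply: IH; exact: ltnW|exact: slab_le].
have := part N (leqnn _); rewrite EFinM muleA.
rewrite (_ : box a (top N) = Q)//; rewrite QE; congr box; apply/rowP => i.
by rewrite !mxE; case: eqP => // ->; rewrite /b divff ?gt_eqF// mulr1.
Qed.

(** Condition F without the smallness assumption on [E]: when [r] exceeds
    [alpha], the factor [(r / alpha) `^ beta >= 1] is free and [weight_cube]
    applies. What remains small is the set [E'] that is removed on the right. *)
Lemma weights_on_cells (N : nat) (Q D E E' : set LRn) (r : R) :
  2 / alpha <= N%:R -> cube Q -> measurable D -> D `<=` Q ->
  mu.-negligible (Q `\` D) -> mu D = mu Q -> measurable E -> measurable E' ->
  E' `<=` E -> E `<=` D -> 0 <= r ->
  (mu E <= r%:E * mu D)%E -> (mu E' <= (alpha / 2)%:E * mu D)%E ->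
  (\int[mu]_(x in E) (w x)%:E <=
   (N.+1%:R * c1 * alpha `^ (- beta) * r `^ beta)%:E *
   \int[mu]_(x in D `\` E') (v x)%:E)%E.
Proof.
move=> Na cQ mD DQ QDnull DQE mE mE' E'E ED r0 Er E'a; have /andP[a0 a1] := alpha01.
have mQ := cube_measurable cQ.
rewrite DQE in Er E'a.
have EQ := subset_trans ED DQ; have E'Q := subset_trans E'E EQ.
have -> : (\int[mu]_(x in D `\` E') (v x)%:E = \int[mu]_(x in Q `\` E') (v x)%:E)%E.
  have mQD : measurable (Q `\` D) by exact: measurableD.
  apply/esym/ge0_integral_null_diff.
  - exact: measurableD.
  - exact: measurableD.
  - exact: setSD.
  - apply: subset_measure0 (measure_negligible mQD QDnull).
    + by apply: measurableD; exact: measurableD.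
    + exact: mQD.
    + by move=> x [[Qx nE'] nDE']; split => // Dx; apply: nDE'.
  - exact: measurable_weight.
  - by move=> x _; rewrite lee_fin.
have ab : 1 <= alpha `^ (- beta).
  rewrite powRN -invr1 lef_pV2 ?posrE ?powR_gt0//.
  by apply: powR_le_one; rewrite ?(ltW a0) ?(ltW a1) ?(ltW beta_gt0).
have X0 : (0 <= \int[mu]_(x in Q `\` E') (v x)%:E)%E by exact: integral_weight_ge0.
have N1 : 1 <= N.+1%:R :> R by rewrite ler1n.
have [ra|ar] := leP r alpha.
  apply: le_trans (condition_F_ratio cQ mE EQ _ Er) _; first by rewrite r0.
  apply: lee_pmul => //.
  - by rewrite lee_fin mulr_ge0 ?powR_ge0// ltW.
  - exact: integral_weight_ge0.
  - rewrite lee_fin ler_wpM2r ?powR_ge0// mulrAC ler_peMl ?(ltW c1_gt0)//.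
    exact: mulr_ege1.
  - apply: integral_weight_sub => //.
    exact: setDS.
apply: (@le_trans _ _ (\int[mu]_(x in Q) (w x)%:E)%E).
  exact: integral_weight_sub.
apply: le_trans (weight_cube Na cQ mE' E'Q E'a) _.
apply: lee_wpmul2r => //; rewrite lee_fin -mulrA ler_peMr//.
  by rewrite mulr_ge0// ltW.
rewrite powRN mulrC ler_pdivlMr ?powR_gt0// mul1r.
by apply: ge0_ler_powR; rewrite ?nnegrE ?(ltW beta_gt0) ?(ltW a0) ?(ltW ar) ?r0.
Qed.

End weights.

(** * Stopping times along nested partitions *)

(** The dyadic cells enter only through the following data: a sequence of nested
    countable partitions, the medians [m k x] and the oscillation bounds
    [lam k x] attached to the cell of level [k] around [x], and the weak density
    theorem for the proportion [theta], which is [1 - t] in the application. *)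
Section stopping_time.
Context d (T : measurableType d) (R : realType) (mu : {measure set T -> \bar R}).
Context (cell : nat -> T -> nat).
Hypothesis mcell : forall k j, measurable [set x | cell k x = j].
Hypothesis nested : forall k x y, cell k.+1 x = cell k.+1 y -> cell k x = cell k y.

Definition same_cell k x : set T := [set y | cell k y = cell k x].
Local Notation D := same_cell.

Hypothesis D_fin : forall k x, (mu (D k x) < +oo)%E.
Hypothesis D_gt0 : forall k x, (0 < mu (D k x))%E.

Lemma nested_le j k x y : (j <= k)%N -> cell k x = cell k y -> cell j x = cell j y.
Proof. by move=> /subnK <-; elim: (k - j)%N => //= e IH /nested. Qed.

Lemma cell_sub j k x : (j <= k)%N -> D k x `<=` D j x.
Proof. by move=> jk y; exact: nested_le. Qed.

Lemma eq_cell k x y : cell k y = cell k x -> D k y = D k x.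
Proof. by rewrite /same_cell => ->. Qed.

Lemma measurable_cell k x : measurable (D k x).
Proof. exact: mcell. Qed.

Lemma measurable_saturated k (S : set T) :
  (forall x y, cell k x = cell k y -> S x -> S y) -> measurable S.
Proof.
move=> sat; rewrite (_ : S = \bigcup_(j in cell k @` S) [set x | cell k x = j]).
  by apply: bigcup_measurable => j _; exact: mcell.
apply/seteqP; split => [x Sx|x [_ [y Sy <-]] /= xy]; first by exists (cell k x).
exact: sat Sy.
Qed.

Lemma measurable_cell_fun d' (T' : measurableType d') k (g : T -> T') :
  (forall x y, cell k x = cell k y -> g x = g y) -> measurable_fun setT g.
Proof.
move=> gk _ B mB; rewrite setTI.
by apply: (@measurable_saturated k) => x y /gk /= <-.
Qed.

Context (f : T -> R) (m lam : nat -> T -> R) (s theta K : R).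
Hypothesis mf : measurable_fun setT f.
Hypothesis m_cell : forall k x y, cell k x = cell k y -> m k x = m k y.
Hypothesis lam_cell : forall k x y, cell k x = cell k y -> lam k x = lam k y.
Hypothesis lam_ge0 : forall k x, 0 <= lam k x.
Hypothesis lamS : forall k x, lam k x <= lam k.+1 x.
Hypothesis s_gt0 : 0 < s.
Hypothesis s_lt : s < theta.
Hypothesis s_theta : s + theta < 1.
Hypothesis K_ge0 : 0 <= K.

Definition deviates k x : set T := [set y | 2 * lam k x < `|f y - m k x|].
Local Notation E := deviates.

Hypothesis deviates_small :
  forall k x, (mu (D k x `&` E k x) <= s%:E * mu (D k x))%E.
Hypothesis m_step : forall k x, `|m k.+1 x - m k x| <= K * lam k.+1 x.
Hypothesis density : forall (A : set T) k0, measurable A -> (mu A < +oo)%E ->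
  (forall k x, (k0 <= k)%N -> A x -> (mu (A `&` D k x) <= theta%:E * mu (D k x))%E) ->
  mu A = 0%E.

Let theta_gt0 : 0 < theta. Proof. exact: lt_trans s_lt. Qed.

Lemma eq_deviates k x y : cell k x = cell k y -> E k x = E k y.
Proof. by move=> xy; rewrite /deviates (lam_cell xy) (m_cell xy). Qed.

Lemma measurable_deviates k x : measurable (E k x).
Proof.
rewrite (_ : E k x = (fun y => `|f y - m k x|) @^-1` `]2 * lam k x, +oo[).
  rewrite -[X in measurable X]setTI; apply: measurableT_comp => //.
  exact: measurable_funB.
by apply/seteqP; split => y; rewrite /= in_itv /= andbT.
Qed.

Lemma lam_homo j k x : (j <= k)%N -> lam j x <= lam k x.
Proof.
by move=> /subnK <-; elim: (k - j)%N => //= e IH; exact: le_trans (lamS _ _).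
Qed.

(** Along the cells that shrink to [x], the cell of level [k] is bad with respect
    to an earlier level [j] when [f] deviates from the median of level [j] on more
    than the proportion [theta] of it. The process stops at the first bad cell,
    which becomes the new reference, called the anchor; [gen k x] counts the
    stops up to level [k]. *)
Definition bad j k x : bool := `[< (theta%:E * mu (D k x) < mu (D k x `&` E j x))%E >].

Fixpoint anchor k x : nat :=
  if k is k'.+1 then if bad (anchor k' x) k x then k else anchor k' x else 0%N.

Fixpoint gen k x : nat :=
  if k is k'.+1 then (bad (anchor k' x) k x + gen k' x)%N else 0%N.

Definition stops k x : bool := anchor k x == k.

Lemma anchor_le k x : (anchor k x <= k)%N.
Proof. by elim: k => //= k IH; case: ifP => // _; exact: leqW. Qed.

Lemma stopsE k x : stops k.+1 x = bad (anchor k x) k.+1 x.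
Proof.
rewrite /stops /=; case: ifP => _; first by rewrite eqxx.
by apply/negbTE; rewrite neq_ltn ltnS anchor_le.
Qed.

Lemma genS k x : gen k.+1 x = (stops k.+1 x + gen k x)%N.
Proof. by rewrite stopsE. Qed.

Lemma anchorS k x : anchor k.+1 x = if stops k.+1 x then k.+1 else anchor k x.
Proof. by rewrite stopsE. Qed.

Lemma anchor_gen_cell k x y : cell k x = cell k y ->
  anchor k x = anchor k y /\ gen k x = gen k y.
Proof.
elim: k => //= k IH xy; have [ancxy genxy] := IH (nested xy).
have -> : bad (anchor k x) k.+1 x = bad (anchor k y) k.+1 y.
  rewrite /bad (eq_cell xy) ancxy (@eq_deviates _ x y)//.
  by apply: nested_le xy; apply: leqW; exact: anchor_le.
by rewrite ancxy genxy.
Qed.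

Lemma eq_anchor k x y : cell k x = cell k y -> anchor k x = anchor k y.
Proof. by move=> /anchor_gen_cell[]. Qed.

Lemma eq_gen k x y : cell k x = cell k y -> gen k x = gen k y.
Proof. by move=> /anchor_gen_cell[]. Qed.

Lemma gen_homo j k x : (j <= k)%N -> (gen j x <= gen k x)%N.
Proof.
by move=> /subnK <-; elim: (k - j)%N => //= e IH; rewrite (leq_trans IH)// leq_addl.
Qed.

Lemma anchor_homo j k x : (j <= k)%N -> (anchor j x <= anchor k x)%N.
Proof.
move=> /subnK <-; elim: (k - j)%N => //= e IH; rewrite (leq_trans IH)//.
by case: ifP => // _; apply: leqW; exact: anchor_le.
Qed.

Lemma stops_anchor k x : stops (anchor k x) x.
Proof.
elim: k => [|k IH]; first by rewrite /stops.
by rewrite anchorS; case: ifP.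
Qed.

Lemma anchor_between j k x : (anchor k x <= j <= k)%N -> anchor j x = anchor k x.
Proof.
move=> /andP[kj jk]; apply/eqP; rewrite eqn_leq anchor_homo//=.
by have := anchor_homo x kj; rewrite (eqP (stops_anchor k x)).
Qed.

(** A cell is never bad with respect to its own anchor: either it has been tested,
    or it is the anchor itself and [s < theta]. *)
Lemma anchor_good k x :
  (mu (D k x `&` E (anchor k x) x) <= theta%:E * mu (D k x))%E.
Proof.
have good j : (mu (D j x `&` E j x) <= theta%:E * mu (D j x))%E.
  apply: le_trans (deviates_small j x) _.
  by apply: lee_wpmul2r => //; rewrite lee_fin ltW.
case: k => [|k]; first exact: good.
rewrite anchorS; case: ifPn => [_|]; first exact: good.
by rewrite stopsE => /asboolPn /negP; rewrite -leNgt.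
Qed.

Lemma measurable_gen_gt k i : measurable [set y | (i < gen k y)%N].
Proof. by apply: (@measurable_saturated k) => x y /eq_gen /= ->. Qed.

(** The geometric decay. A bad cell has at most [1 / theta] times the measure of
    the part of it where [f] deviates from the median of the anchor, and those
    parts fill at most the proportion [s] of the anchor. Each new generation
    therefore loses a factor [s / theta]. Only the finitely many levels from [k]
    to [e + k] matter here, so that the induction is on [e] and the cells of the
    next level are the only ones to be summed over. *)
Lemma gen_decay e k i x :
  (mu (D k x `&` [set y | (gen k x + i < gen (e + k) y)%N]) <=
   ((s / theta) ^+ i / theta)%:E * mu (D k x `&` E (anchor k x) x))%E.
Proof.
have c_ge0 j : 0 <= (s / theta) ^+ j / theta by rewrite divr_ge0 ?exprn_ge0 ?divr_ge0// ltW.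
elim: e k i x => [k i x|e IH k i x].
  rewrite (_ : _ `&` _ = set0) ?measure0 ?mule_ge0 ?lee_fin//.
  rewrite -subset0 => y [/eq_gen /= yx]; rewrite add0n yx.
  by rewrite ltnNge leq_addr.
apply: (@le_measure_fibers _ _ _ mu (cell k.+1)) => //.
- by apply: measurableI; [exact: measurable_cell|exact: measurable_gen_gt].
- by apply: measurableI; [exact: measurable_cell|exact: measurable_deviates].
move=> y [xy _]; rewrite -/(D k.+1 y).
have Dy := @cell_sub k k.+1 y (leqnSn _).
rewrite /= in xy.
have -> : D k x `&` E (anchor k x) x `&` D k.+1 y = D k.+1 y `&` E (anchor k y) y.
  rewrite -(eq_anchor xy) (@eq_deviates _ x y); last first.
    by apply/esym/(nested_le _ xy)/anchor_le.
  by rewrite setIC setIA [D k.+1 y `&` _]setIidl// -(eq_cell xy).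
have -> : D k x `&` [set z | (gen k x + i < gen (e.+1 + k) z)%N] `&` D k.+1 y =
  D k.+1 y `&` [set z | (gen k y + i < gen (e + k.+1) z)%N].
  by rewrite addSnnS (eq_gen xy) setIC setIA [D k.+1 y `&` _]setIidl// -(eq_cell xy).
case: (boolP (stops k.+1 y)) => st; last first.
  have -> : anchor k y = anchor k.+1 y by rewrite anchorS (negbTE st).
  have -> : gen k y = gen k.+1 y by rewrite genS (negbTE st).
  exact: IH.
have := st; rewrite stopsE => /asboolP /ltW bd.
have {}bd : (mu (D k.+1 y) <= (theta^-1)%:E * mu (D k.+1 y `&` E (anchor k y) y))%E.
  by rewrite lee_pdivlMl.
case: i => [|i].
  rewrite expr0 div1r; apply: le_trans bd; apply: le_measure; rewrite ?inE.
  - by apply: measurableI; [exact: measurable_cell|exact: measurable_gen_gt].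
  - exact: measurable_cell.
  - by move=> ? [].
have -> : (gen k y + i.+1 = gen k.+1 y + i)%N by rewrite genS st addnS.
apply: le_trans (IH _ _ _) _.
have anc : anchor k.+1 y = k.+1 by exact/eqP.
rewrite anc.
apply: (@le_trans _ _ (((s / theta) ^+ i / theta)%:E * (s%:E * mu (D k.+1 y)))%E).
  by apply: lee_wpmul2l; [rewrite lee_fin|exact: deviates_small].
apply: (@le_trans _ _ (((s / theta) ^+ i.+1)%:E * mu (D k.+1 y))%E).
  rewrite muleA -EFinM exprS.
  by rewrite (_ : _ * s = s / theta * (s / theta) ^+ i)//; ring.
rewrite EFinM -muleA; apply: lee_wpmul2l => //.
by rewrite lee_fin exprn_ge0// divr_ge0// ltW.
Qed.

Definition reach i : set T := [set x | exists k, (i <= gen k x)%N].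

Lemma measurable_gen_ge k i : measurable [set y | (i <= gen k y)%N].
Proof. by apply: (@measurable_saturated k) => x y /eq_gen /= ->. Qed.

Lemma reachE i : reach i = \bigcup_k [set x | (i <= gen k x)%N].
Proof. by apply/seteqP; split => x [k]; [exists k|move=> _; exists k]. Qed.

Lemma measurable_reach i : measurable (reach i).
Proof. by rewrite reachE; apply: bigcup_measurable => k _; exact: measurable_gen_ge. Qed.

Lemma reach_sub i j : (i <= j)%N -> reach j `<=` reach i.
Proof. by move=> ij x [k jk]; exists k; exact: leq_trans jk. Qed.

Lemma rho_ge0 : 0 <= s / theta.
Proof. by rewrite divr_ge0// ltW. Qed.

Lemma reach_decay k i x : stops k x ->
  (mu (D k x `&` reach (gen k x + i)) <= ((s / theta) ^+ i)%:E * mu (D k x))%E.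
Proof.
move=> st.
have fin_level e :
  (mu (D k x `&` [set y | (gen k x + i <= gen (e + k) y)%N])
     <= ((s / theta) ^+ i)%:E * mu (D k x))%E.
  case: i => [|i].
    rewrite expr0 mul1e; apply: le_measure; rewrite ?inE.
    - by apply: measurableI; [exact: measurable_cell|exact: measurable_gen_ge].
    - exact: measurable_cell.
    - by move=> ? [].
  under eq_set do rewrite addnS.
  apply: le_trans (gen_decay _ _ _ _) _; rewrite (eqP st).
  apply: (@le_trans _ _ (((s / theta) ^+ i / theta)%:E * (s%:E * mu (D k x)))%E).
    apply: lee_wpmul2l; [|exact: deviates_small].
    by rewrite lee_fin divr_ge0 ?exprn_ge0 ?rho_ge0// ltW.
  by rewrite muleA -EFinM exprS (_ : _ * s = s / theta * (s / theta) ^+ i)//; ring.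
pose F e := D k x `&` [set y | (gen k x + i <= gen (e + k) y)%N].
have mF e : measurable (F e).
  by apply: measurableI; [exact: measurable_cell|exact: measurable_gen_ge].
have -> : D k x `&` reach (gen k x + i) = \bigcup_e F e.
  apply/seteqP; split => [y [xy [j ij]]|y [e _ [xy ij]]]; last by split => //; exists (e + k)%N.
  by exists j => //; split => //=; apply: leq_trans ij _; apply: gen_homo; exact: leq_addr.
have cvF : mu \o F @ \oo --> mu (\bigcup_e F e).
  apply: nondecreasing_cvg_mu => //; first exact: bigcup_measurable.
  apply/nondecreasing_seqP => e; apply/subsetPset => y [xy ij]; split => //=.
  by apply: leq_trans ij _; exact: leq_addl.
by apply: (cvge_to_le cvF); apply: nearW => e; exact: fin_level.
Qed.

Lemma stops0 x : stops 0 x. Proof. by []. Qed.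

Lemma reach_infinite_null x : mu (D 0 x `&` \bigcap_i reach i) = 0%E.
Proof.
have mO : measurable (D 0 x `&` \bigcap_i reach i).
  apply: measurableI; first exact: measurable_cell.
  by apply: bigcap_measurable => // i _; exact: measurable_reach.
have le_i i : (mu (D 0 x `&` \bigcap_i reach i) <= ((s / theta) ^+ i)%:E * mu (D 0 x))%E.
  apply: le_trans (reach_decay i (stops0 x)); apply: le_measure; rewrite ?inE//.
    by apply: measurableI; [exact: measurable_cell|exact: measurable_reach].
  by move=> y [xy h]; split => //; exact: h.
have mu_fin : mu (D 0 x) \is a fin_num by rewrite ge0_fin_numE.
have cv : (((s / theta) ^+ i)%:E * mu (D 0 x))%E @[i --> \oo] --> (0%:E * mu (D 0 x))%E.
  apply: cvgeZr => //; apply: cvg_EFin; first exact: nearW.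
  apply: (@cvg_expr _ (s / theta)).
  by rewrite ger0_norm ?rho_ge0// ltr_pdivrMr// mul1r.
apply/eqP; rewrite eq_le measure_ge0 andbT -[leRHS](mul0e (mu (D 0 x))).
by apply: (cvge_to_ge cv); exact: nearW.
Qed.

(** On the set where [j] remains the anchor forever, every cell around a point is
    good with respect to [j]; the subset where [f] still deviates from the median
    of level [j] thus satisfies the hypothesis of the density theorem. *)
Lemma last_anchor_negligible j x : mu.-negligible
  (D 0 x `&` [set y | (forall k, (j <= k)%N -> anchor k y = j) /\ E j y y]).
Proof.
set A := D 0 x `&` _.
have mA : measurable A.
  apply: measurableI; first exact: measurable_cell.
  rewrite (_ : [set y | _] =
     (\bigcap_(k in [set k | (j <= k)%N]) [set y | anchor k y = j]) `&` [set y | E j y y]); last first.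
    by apply/seteqP; split.
  apply: measurableI.
    apply: bigcap_measurableType => k _.
    by apply: (@measurable_saturated k) => y z /eq_anchor /= ->.
  rewrite (_ : [set y | E j y y] =
     (fun y => `|f y - m j y| - 2 * lam j y) @^-1` `]0, +oo[).
    rewrite -[X in measurable X]setTI.
    have mm : measurable_fun setT (m j) by apply: (@measurable_cell_fun _ _ j) => y z; exact: m_cell.
    have ml : measurable_fun setT (lam j) by apply: (@measurable_cell_fun _ _ j) => y z; exact: lam_cell.
    have : measurable_fun setT (fun y => `|f y - m j y| - 2 * lam j y).
      apply: measurable_funB; last exact: measurable_funM.
      by apply: measurableT_comp => //; exact: measurable_funB.
    by apply.
  by apply/seteqP; split => y; rewrite /= in_itv /= andbT subr_gt0.
apply/negligibleP => //.
have Afin : (mu A < +oo)%E.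
  apply: (le_lt_trans _ (D_fin 0 x)); apply: le_measure; rewrite ?inE//.
    exact: measurable_cell.
  by move=> ? [].
apply: (@density _ j mA Afin) => k y jk [_ [/(_ k jk) ancy _]].
apply: le_trans (anchor_good k y); apply: le_measure; rewrite ?inE.
- by apply: measurableI; [exact: mA|exact: measurable_cell].
- by apply: measurableI; [exact: measurable_cell|exact: measurable_deviates].
move=> z [[_ [_ Ez]] zy]; split => //.
by rewrite ancy (@eq_deviates _ y z)//; apply: nested_le (esym zy).
Qed.

Lemma eventually_anchored x : (exists i, ~ reach i x) ->
  exists2 j, stops j x & forall k, (j <= k)%N -> anchor k x = j.
Proof.
move=> [i nio].
have gi k : (gen k x < i)%N by rewrite ltnNge; apply/negP => ik; apply: nio; exists k.
pose P g := `[< exists k, gen k x = g >].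
have exP : exists g, P g by exists (gen 0 x); apply/asboolP; exists 0%N.
have ubP g : P g -> (g <= i)%N by move=> /asboolP[k <-]; rewrite ltnW.
have [g /asboolP[k0 gk0] gmax] := ex_maxnP exP ubP.
have stuck k : (k0 <= k)%N -> anchor k x = anchor k0 x.
  move=> /subnK <-; elim: (k - k0)%N => // e IH; rewrite addSn anchorS IH; case: ifPn => // st.
  have : (gen (e + k0).+1 x <= g)%N by apply: gmax; apply/asboolP; exists (e + k0).+1.
  by rewrite genS st -gk0 add1n ltnNge gen_homo// leq_addl.
exists (anchor k0 x); first exact: stops_anchor.
move=> k jk; have [kk0|/ltnW/stuck//] := leqP k k0.
by apply: anchor_between; rewrite jk.
Qed.

Lemma ae_last_anchor x0 : mu.-negligible (D 0 x0 `&` [set x |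
  ~ exists2 j, stops j x & `|f x - m j x| <= 2 * lam j x]).
Proof.
apply: (@negligibleS _ _ _ mu ((D 0 x0 `&` \bigcap_i reach i) `|` \bigcup_j (D 0 x0 `&`
   [set y | (forall k, (j <= k)%N -> anchor k y = j) /\ E j y y]))).
  move=> x [x0x nj].
  have [om|nom] := pselect ((\bigcap_i reach i) x); first by left.
  right; have [|j st jx] := @eventually_anchored x.
    by apply: contrapT => h; apply: nom => i _; apply: contrapT => ni; apply: h; exists i.
  exists j => //; do 2?split => //; rewrite /deviates /= ltNge; apply/negP => fj.
  by apply: nj; exists j.
apply: negligibleU.
  apply/negligibleP; last exact: reach_infinite_null.
  apply: measurableI; first exact: measurable_cell.
  by apply: bigcap_measurable => // i _; exact: measurable_reach.
by apply: negligible_bigcup => j; exact: last_anchor_negligible.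
Qed.

(** The cell before the stop is not bad with respect to the anchor and has its own
    median, with exceptional sets of proportions [theta] and [s]. As
    [s + theta < 1], a point outside both compares the two medians; [m_step] adds
    the last level. *)
Lemma jump_le k x : stops k.+1 x ->
  `|m k.+1 x - m (anchor k x) x| <= (4 + K) * lam k.+1 x.
Proof.
move=> _; set j := anchor k x.
have jk : (j <= k)%N by exact: anchor_le.
have [y [xy nEj nEk]] : exists y, [/\ D k x y, ~ E j x y & ~ E k x y].
  apply: contrapT => /forallNP h.
  have sub : D k x `<=` (D k x `&` E j x) `|` (D k x `&` E k x).
    move=> y xy; have := h y => /not_and3P[//|/contrapT ?|/contrapT ?]; [by left|by right].
  have mI i : measurable (D k x `&` E i x).
    by apply: measurableI; [exact: measurable_cell|exact: measurable_deviates].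
  have : (mu (D k x) <= theta%:E * mu (D k x) + s%:E * mu (D k x))%E.
    apply: (@le_trans _ _ (mu ((D k x `&` E j x) `|` (D k x `&` E k x)))).
      by apply: le_measure; rewrite ?inE//; [exact: measurable_cell|exact: measurableU].
    apply: le_trans (measureU2 _ _ _) _ => //.
    by apply: leeD; [exact: anchor_good|exact: deviates_small].
  have mu_fin : mu (D k x) \is a fin_num by rewrite ge0_fin_numE.
  have := D_gt0 k x; rewrite -(fineK mu_fin) -!EFinM -EFinD lte_fin lee_fin => M0 M1.
  have h1 : 0 < 1 - s - theta by move: s_theta; lra.
  by have := mulr_gt0 h1 M0; lra.
move: nEj nEk; rewrite /deviates /= => /negP; rewrite -leNgt => h1 /negP; rewrite -leNgt => h2.
have h3 := m_step k x; have h4 := lam_homo x jk; have h5 := lamS k x.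
have := ler_distD (f y) (m j x) (m k x); have := ler_distD (m k x) (m k.+1 x) (m j x).
rewrite (distrC (m j x) (f y)) (distrC (m j x) (m k x)).
by nra.
Qed.

Arguments gen : simpl never.
Arguments stops : simpl never.

(** Generations increase by one at each stop, so at most [e] stops lie within [e]
    generations of the last one. *)
Lemma count_late_stops e n x :
  (\sum_(k < n.+1 | stops k x && (gen n x < gen k x + e)) 1 <= e)%N.
Proof.
elim: n e => [e|n IH e].
  rewrite big_mkcond big_ord_recl big_ord0 /= addn0; case: e => //= e.
rewrite big_mkcond big_ord_recr /= -big_mkcond /=.
case: (boolP (stops n.+1 x)) => /= st; last first.
  by rewrite addn0 genS (negbTE st) add0n; exact: IH.
case: e => [|e].
  rewrite addn0 ltnn addn0 big1//= => k /andP[_]; rewrite addn0 ltnNge.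
  by rewrite gen_homo// ltnW.
rewrite -[X in (_ <= X)%N]addn1; apply: leq_add; last by case: ifP.
rewrite (eq_bigl (fun k : 'I_n.+1 => stops k x && (gen n x < gen k x + e)%N)); first exact: IH.
by move=> k; rewrite genS st add1n addnS ltnS.
Qed.

(** * The weighted estimate for stopping times *)

Context (Phi : R -> R) (c0 : R) (p : nat).
Hypothesis Phi0 : Phi 0 = 0.
Hypothesis Phi_homo : forall x y : R, 0 <= x -> x <= y -> Phi x <= Phi y.
Hypothesis Phi_double : forall x : R, 0 <= x -> Phi (2 * x) <= c0 * Phi x.
Hypothesis mPhi : measurable_fun setT (fun x : R => Phi `|x|).
Hypothesis c0_ge1 : 1 <= c0.
Hypothesis K_le : 4 + K <= 2 ^+ p.

Let c0_ge0 : 0 <= c0. Proof. exact: le_trans c0_ge1. Qed.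

Lemma Phi_ge0 x : 0 <= x -> 0 <= Phi x.
Proof. by move=> x0; rewrite -Phi0; exact: Phi_homo. Qed.

Lemma Phi_add x y : 0 <= x -> 0 <= y -> Phi (x + y) <= c0 * (Phi x + Phi y).
Proof.
move=> x0 y0; wlog xy : x y x0 y0 / x <= y.
  by move=> h; have [/h|/ltW/h] := leP x y; [exact|rewrite addrC [Phi x + _]addrC; exact].
apply: (@le_trans _ _ (Phi (2 * y))).
  by apply: Phi_homo; [exact: addr_ge0|lra].
apply: le_trans (Phi_double y0) _; apply: ler_wpM2l => //.
by rewrite lerDr Phi_ge0.
Qed.

Lemma Phi_pow2 q x : 0 <= x -> Phi (2 ^+ q * x) <= c0 ^+ q * Phi x.
Proof.
move=> x0; elim: q => [|q IH]; first by rewrite !expr0 !mul1r.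
rewrite !exprS -!mulrA; apply: le_trans (Phi_double _) _.
  by rewrite mulr_ge0// exprn_ge0.
exact: ler_wpM2l.
Qed.

Lemma Phi_scale x : 0 <= x -> Phi ((4 + K) * x) <= c0 ^+ p * Phi x.
Proof.
move=> x0; apply: le_trans (Phi_pow2 _ x0); apply: Phi_homo.
  by rewrite mulr_ge0// addr_ge0.
exact: ler_wpM2r.
Qed.

Definition chain_sum k x : R := \sum_(j < k.+1 | stops j x) (4 + K) * lam j x.

Lemma chain_sumS k x : chain_sum k.+1 x =
  chain_sum k x + (if stops k.+1 x then (4 + K) * lam k.+1 x else 0).
Proof. by rewrite /chain_sum big_mkcond big_ord_recr /= -big_mkcond. Qed.

Lemma chain_term_ge0 j x : 0 <= (4 + K) * lam j x.
Proof. by rewrite mulr_ge0// addr_ge0. Qed.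

Lemma chain_sum_ge0 k x : 0 <= chain_sum k x.
Proof. by apply: sumr_ge0 => j _; exact: chain_term_ge0. Qed.

Lemma anchor_dist k x : `|m (anchor k x) x - m 0 x| <= chain_sum k x.
Proof.
elim: k => [|k IH]; first by rewrite subrr normr0 chain_sum_ge0.
rewrite anchorS chain_sumS; case: ifPn => [st|_]; last by rewrite addr0.
rewrite [leRHS]addrC; apply: le_trans (ler_distD (m (anchor k x) x) _ _) _.
exact: lerD (jump_le st) IH.
Qed.

(** Each stop costs one doubling for all earlier terms: a sum of two terms is at
    most twice the larger one. The term of a stop thus carries a power of [c0]
    whose exponent is the number of generations elapsed since that stop. *)
Lemma Phi_chain k x : Phi (chain_sum k x) <=
  \sum_(j < k.+1 | stops j x) c0 ^+ (gen k x - gen j x + p.+1) * Phi (lam j x).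
Proof.
have step j : Phi ((4 + K) * lam j x) <= c0 ^+ p * Phi (lam j x) by exact: Phi_scale.
elim: k => [|k IH].
  rewrite /chain_sum big_mkcond [leRHS]big_mkcond !big_ord_recl !big_ord0 /= !addr0 subnn add0n.
  apply: le_trans (step _) _; rewrite exprS -mulrA ler_peMl// mulr_ge0 ?exprn_ge0//.
  exact: Phi_ge0.
rewrite chain_sumS [leRHS]big_mkcond big_ord_recr /= -big_mkcond.
rewrite -/(gen k.+1 x) subnn add0n; case: ifPn => [st|nst]; last first.
  by rewrite !addr0 /= genS (negbTE nst) add0n.
apply: le_trans (Phi_add (chain_sum_ge0 _ _) (chain_term_ge0 _ _)) _.
rewrite mulrDr exprS -mulrA; apply: lerD; last by apply: ler_wpM2l => //; exact: step.
apply: le_trans (ler_wpM2l c0_ge0 IH) _; rewrite mulr_sumr.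
apply: ler_sum => j _; rewrite mulrA -exprS -addSn genS st add1n subSn//.
by apply: gen_homo; rewrite -ltnS.
Qed.

Lemma Phi_deviation j x : stops j x -> `|f x - m j x| <= 2 * lam j x ->
  Phi `|f x - m 0 x| <=
  c0 ^+ p.+2 * \sum_(i < j.+1 | stops i x) c0 ^+ (gen j x - gen i x) * Phi (lam i x).
Proof.
move=> st fj.
have anc : anchor j x = j by exact/eqP.
have fS : `|f x - m 0 x| <= 2 * chain_sum j x.
  apply: le_trans (ler_distD (m j x) _ _) _.
  have := anchor_dist j x; rewrite anc => d0.
  have : 2 * lam j x <= chain_sum j x.
    rewrite /chain_sum (bigD1 ord_max)//=.
    apply: (@le_trans _ _ ((4 + K) * lam j x)).
      by apply: ler_wpM2r => //; move: K_ge0; lra.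
    by rewrite lerDl sumr_ge0// => i _; exact: chain_term_ge0.
  by lra.
apply: le_trans (Phi_homo (normr_ge0 _) fS) _.
apply: le_trans (Phi_double (chain_sum_ge0 _ _)) _.
apply: le_trans (ler_wpM2l c0_ge0 (Phi_chain _ _)) _.
rewrite exprS -mulrA; apply: ler_wpM2l => //; rewrite mulr_sumr.
by apply: ler_sum => i _; rewrite addnC exprD mulrA.
Qed.

(** [q] generations make the proportion [(s / theta) ^+ q] small enough to be
    removed in [weights]; [B] bounds the series that remains in the end. *)
Context (w v : T -> R) (CF beta eta B : R) (q : nat).
Hypothesis mw : measurable_fun setT w.
Hypothesis mv : measurable_fun setT v.
Hypothesis w_ge0 : forall x, 0 <= w x.
Hypothesis v_ge0 : forall x, 0 <= v x.
Hypothesis CF_ge0 : 0 <= CF.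
Hypothesis weights : forall k x (F E' : set T) r, measurable F -> measurable E' ->
  E' `<=` F -> F `<=` D k x -> 0 <= r ->
  (mu F <= r%:E * mu (D k x))%E -> (mu E' <= eta%:E * mu (D k x))%E ->
  (\int[mu]_(y in F) (w y)%:E <=
     (CF * r `^ beta)%:E * \int[mu]_(y in D k x `\` E') (v y)%:E)%E.
Hypothesis q_small : (s / theta) ^+ q <= eta.
Hypothesis B_gt0 : 0 < B.

Let gam : R := c0 * (s / theta) `^ beta.
Hypothesis B_bound : forall N, \sum_(i < N) gam ^+ i * (i + q)%:R <= B.

Let gam_ge0 : 0 <= gam. Proof. by rewrite mulr_ge0// powR_ge0. Qed.

Definition stop_reaching i e : set T := [set x | stops i x /\ reach (gen i x + e) x].
Definition stop_short i e : set T := [set x | stops i x /\ ~ reach (gen i x + e) x].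

Lemma stops_cell k x y : cell k x = cell k y -> stops k x = stops k y.
Proof. by rewrite /stops => /eq_anchor ->. Qed.

Lemma measurable_stop_reaching i e : measurable (stop_reaching i e).
Proof.
rewrite (_ : stop_reaching i e = \bigcup_g ([set x | stops i x /\ gen i x = g] `&` reach (g + e))).
  apply: bigcup_measurable => g _; apply: measurableI; last exact: measurable_reach.
  apply: (@measurable_saturated i) => x y xy [st <-]; rewrite /= -(stops_cell xy).
  by split => //; apply/esym/eq_gen.
by apply/seteqP; split => [x [st om]|x [g _ [[st /= <-] om]]]; [exists (gen i x)|].
Qed.

Lemma measurable_stop_short i e : measurable (stop_short i e).
Proof.
rewrite (_ : stop_short i e = [set x | stops i x] `\` stop_reaching i e).
  apply: measurableD; last exact: measurable_stop_reaching.
  by apply: (@measurable_saturated i) => x y /stops_cell /= ->.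
apply/seteqP; split => x [st no]; split => //; first by case=> _ /no.
by move=> om; apply: no; split.
Qed.

(** On a cell of generation [g], the points reaching generation [g + e] fill at
    most the proportion [(s / theta) ^+ e]; condition F moves their [w]-mass to the
    [v]-mass of the points of the cell that stop before generation
    [g + e + q]. *)
Lemma integral_stop_reaching_le i e x0 :
  (\int[mu]_(x in D 0 x0) (\1_(stop_reaching i e) x * Phi (lam i x) * w x)%:E <=
   (CF * ((s / theta) ^+ e) `^ beta)%:E *
   \int[mu]_(x in D 0 x0) (\1_(stop_short i (e + q)) x * Phi (lam i x) * v x)%:E)%E.
Proof.
have mPl : measurable_fun setT (fun x => Phi (lam i x)).
  by apply: (@measurable_cell_fun _ _ i) => x y /lam_cell ->.
have Pl0 x : 0 <= Phi (lam i x) by exact: Phi_ge0.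
have mcell0 := measurable_cell 0 x0.
apply: (@le_integral_fibers _ _ _ mu (cell i)) => //.
- by rewrite mulr_ge0// powR_ge0.
- apply/measurable_EFinP; apply: measurable_funTS; do 2?apply: measurable_funM => //.
  by apply: measurable_indic; exact: measurable_stop_reaching.
- apply/measurable_EFinP; apply: measurable_funTS; do 2?apply: measurable_funM => //.
  by apply: measurable_indic; exact: measurable_stop_short.
- by move=> x _; rewrite lee_fin !mulr_ge0// indicE.
- by move=> x _; rewrite lee_fin !mulr_ge0// indicE.
move=> x x0x; rewrite -/(D i x).
have -> : D 0 x0 `&` D i x = D i x.
  rewrite setIidr// => y /(cell_sub (leq0n i)) xy; rewrite /same_cell /= in x0x xy *.
  by rewrite xy.
have [st|nst] := boolP (stops i x); last first.
  rewrite integral0_eq ?mule_ge0//; first by rewrite lee_fin mulr_ge0// powR_ge0.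
    by apply: integral_ge0 => y _; rewrite lee_fin !mulr_ge0// indicE.
  move=> y xy; rewrite indicE memNset ?mul0r// => -[].
  by rewrite (stops_cell xy) (negbTE nst).
have restr (A : set T) (u : T -> R) (I : set T) : measurable_fun setT u ->
    (forall y, 0 <= u y) -> measurable A ->
    (forall y, D i x y -> I y <-> A y) ->
    (\int[mu]_(y in D i x) (\1_I y * Phi (lam i y) * u y)%:E =
     (Phi (lam i x))%:E * \int[mu]_(y in D i x `&` A) (u y)%:E)%E.
  move=> mu_ u0 mA IA.
  have muE : measurable_fun (D i x) (fun y => (u y)%:E).
    by apply/measurable_EFinP; exact: measurable_funTS.
  have mD := measurable_cell i x.
  rewrite integral_mkcondr -ge0_integralZl//; last 2 first.
  - by move=> y _; rewrite patchE; case: ifP => // _; rewrite lee_fin.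
  - by rewrite lee_fin.
  2: { apply/(measurable_restrict _ mA mD).
       by apply: measurable_funS muE => // y []. }
  apply: eq_integral => y /set_mem xy.
  rewrite (lam_cell xy) patchE indicE.
  have [Ay|nAy] := boolP (y \in A).
    by rewrite mem_set/= ?mul1r//; apply/(IA y xy)/set_mem.
  rewrite memNset ?mul0r ?mule0// => /(IA y xy) Ay; move: nAy; rewrite mem_set//.
rewrite (@restr (reach (gen i x + e)) w)//; first last.
- move=> y xy; rewrite /stop_reaching /= (stops_cell xy) (eq_gen xy); tauto.
- exact: measurable_reach.
rewrite (@restr (~` reach (gen i x + (e + q))) v)//; first last.
- move=> y xy; rewrite /stop_short /= (stops_cell xy) (eq_gen xy); tauto.
- by apply: measurableC; exact: measurable_reach.
rewrite muleCA; apply: lee_wpmul2l; first by rewrite lee_fin.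
rewrite (_ : D i x `&` ~` _ = D i x `\` (D i x `&` reach (gen i x + (e + q)))); last first.
  by rewrite setDIr setDv set0U.
apply: weights.
- by apply: measurableI; [exact: measurable_cell|exact: measurable_reach].
- by apply: measurableI; [exact: measurable_cell|exact: measurable_reach].
- by apply: setIS; apply: reach_sub; rewrite leq_add2l leq_addr.
- by move=> ? [].
- by rewrite exprn_ge0// rho_ge0.
- exact: reach_decay.
- apply: le_trans (reach_decay _ st) _; apply: lee_wpmul2r => //.
  rewrite lee_fin; apply: le_trans q_small; rewrite exprD ler_piMl ?exprn_ge0 ?rho_ge0//.
  by rewrite exprn_ile1 ?rho_ge0// ler_pdivrMr// mul1r ltW.
Qed.

Let B_ge0 : 0 <= B. Proof. exact: ltW. Qed.
Let Binv_ge0 : 0 <= B^-1. Proof. by rewrite invr_ge0. Qed.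

(** The finite sum of [Phi_deviation] is part of a double series over the level
    [i] of a stop and the number [e] of generations that follow it; the term with
    the actual value of [e] suffices. *)
Lemma Phi_deviation_series j x : stops j x -> `|f x - m j x| <= 2 * lam j x ->
  ((Phi `|f x - m 0 x| * w x)%:E <= \sum_(i <oo) \sum_(e <oo)
    (c0 ^+ (e + p.+2) * (\1_(stop_reaching i e) x * Phi (lam i x) * w x))%:E)%E.
Proof.
move=> st fj.
pose u i e := (c0 ^+ (e + p.+2) * (\1_(stop_reaching i e) x * Phi (lam i x) * w x))%:E.
have u0 i e : (0 <= u i e)%E.
  by rewrite lee_fin !mulr_ge0 ?exprn_ge0 ?indicE ?Phi_ge0.
apply: (@le_trans _ _ (\sum_(0 <= i < j.+1) u i (gen j x - gen i x)%N)%E).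
  rewrite big_mkord sumEFin lee_fin.
  apply: le_trans (ler_wpM2r (w_ge0 x) (Phi_deviation st fj)) _.
  rewrite mulr_sumr mulr_suml big_mkcond; apply: ler_sum => i _; case: ifPn => [sti|_].
    rewrite indicE mem_set; last first.
      by split => //; exists j; rewrite subnKC// gen_homo// -ltnS.
    by rewrite mul1r exprD; move: (c0 ^+ p.+2) => C; rewrite -!mulrA mulrCA.
  by rewrite !mulr_ge0 ?exprn_ge0 ?indicE ?Phi_ge0.
apply: (@le_trans _ _ (\sum_(0 <= i < j.+1) \sum_(e <oo) u i e)%E).
  by apply: lee_sum => i _; apply: (@le_term_nneseries _ (u i)) => e; exact: u0.
by apply: nneseries_lim_ge => i _ _; apply: nneseries_ge0 => e _ _; exact: u0.
Qed.

(** Conversely, a point only sees the stops within [e + q] generations of its last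
    one. There are at most [e + q] of them, each contributing at most
    [Phi (lam N x)] because [lam] increases with the level, and the sum over [e]
    is bounded by [B]. *)
Lemma stop_short_series x (L : \bar R) :
  (forall k, (Phi (lam k x))%:E <= L)%E ->
  (\sum_(i <oo) \sum_(e <oo)
     (B^-1 * gam ^+ e * (\1_(stop_short i (e + q)) x * Phi (lam i x) * v x))%:E
   <= L * (v x)%:E)%E.
Proof.
move=> PhiL.
pose u i e := B^-1 * gam ^+ e * (\1_(stop_short i (e + q)) x * Phi (lam i x) * v x).
have u0 i e : 0 <= u i e.
  by rewrite /u !mulr_ge0 ?exprn_ge0 ?indicE ?Phi_ge0//.
apply: nneseries_le_partial => [i|N].
  by apply: nneseries_ge0 => e _ _; rewrite lee_fin; exact: u0.
rewrite -nneseries_sum_nat; last by move=> i e; rewrite lee_fin; exact: u0.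
apply: nneseries_le_partial => [e|M].
  by apply: sume_ge0 => i _; rewrite lee_fin; exact: u0.
apply: (@le_trans _ _ ((Phi (lam N x))%:E * (v x)%:E)%E); last first.
  by apply: lee_wpmul2r; [rewrite lee_fin|exact: PhiL].
under eq_bigr do rewrite sumEFin.
rewrite sumEFin -EFinM lee_fin.
apply: (@le_trans _ _ (\sum_(0 <= e < M) B^-1 * (gam ^+ e * (e + q)%:R) * (Phi (lam N x) * v x))).
  rewrite !big_mkord; apply: ler_sum => e _.
  rewrite big_mkord.
  apply: (@le_trans _ _ (\sum_(i < N.+1 | stops i x && (gen N x < gen i x + (e + q))%N)
       B^-1 * gam ^+ e * (Phi (lam N x) * v x))); last first.
    rewrite sumr_const -[leLHS]mulr_natr.
    rewrite [leRHS](_ : _ = B^-1 * gam ^+ e * (Phi (lam N x) * v x) * (e + q)%:R); last by ring.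
    apply: ler_wpM2l; first by rewrite !mulr_ge0 ?exprn_ge0 ?Phi_ge0.
    rewrite ler_nat; apply: leq_trans (count_late_stops (e + q) N x).
    by rewrite sum1_card.
  rewrite [leRHS]big_mkcond big_ord_recr /= -[leLHS]addr0; apply: lerD; last first.
    by case: ifP => // _; rewrite !mulr_ge0 ?exprn_ge0 ?Phi_ge0//.
  apply: ler_sum => i _; rewrite /u indicE.
  have [/set_mem[st no]|_] := boolP (x \in _); last first.
    rewrite !mul0r mulr0; case: ifP => // _.
    by rewrite !mulr_ge0 ?exprn_ge0 ?Phi_ge0//.
  rewrite st /= ifT; last by rewrite ltnNge; apply/negP => h; apply: no; exists N.
  rewrite mul1r; apply: ler_wpM2l.
    by rewrite !mulr_ge0 ?exprn_ge0//.
  apply: ler_wpM2r => //; apply: Phi_homo => //; apply: lam_homo.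
  exact: ltnW.
rewrite -mulr_suml -mulr_sumr big_mkord -[leRHS]mul1r; apply: ler_wpM2r.
  by rewrite mulr_ge0 ?Phi_ge0.
by rewrite mulrC ler_pdivrMr// mul1r B_bound.
Qed.

(** Integrating [Phi_deviation_series] against [w], each term is transferred to
    [v] by [integral_stop_reaching_le] and the result is summed pointwise by
    [stop_short_series]. The powers of [c0] and of [(s / theta) `^ beta] combine
    into the powers of [gam]. *)
Theorem stopping_time_estimate x0 (L : T -> \bar R) :
  (forall k x, D 0 x0 x -> ((Phi (lam k x))%:E <= L x)%E) ->
  (\int[mu]_(x in D 0 x0) (Phi `|f x - m 0 x| * w x)%:E <=
   (c0 ^+ p.+2 * CF * B)%:E * \int[mu]_(x in D 0 x0) (L x * (v x)%:E))%E.
Proof.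
move=> PhiL.
have mD := measurable_cell 0 x0.
pose G i e x := (c0 ^+ (e + p.+2) * (\1_(stop_reaching i e) x * Phi (lam i x) * w x))%:E.
pose H i e x :=
  (B^-1 * gam ^+ e * (\1_(stop_short i (e + q)) x * Phi (lam i x) * v x))%:E.
have G0 i e x : (0 <= G i e x)%E.
  by rewrite lee_fin !mulr_ge0 ?exprn_ge0 ?indicE ?Phi_ge0.
have H0 i e x : (0 <= H i e x)%E.
  by rewrite lee_fin !mulr_ge0 ?exprn_ge0 ?indicE ?Phi_ge0//.
have mPl i : measurable_fun setT (fun x => Phi (lam i x)).
  by apply: (@measurable_cell_fun _ _ i) => x y /lam_cell ->.
have mstop_reaching i e : measurable_fun (D 0 x0)
    (fun x => (\1_(stop_reaching i e) x * Phi (lam i x) * w x)%:E).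
  apply/measurable_EFinP; apply: measurable_funTS; do 2?apply: measurable_funM => //.
  by apply: measurable_indic; exact: measurable_stop_reaching.
have mstop_short i e : measurable_fun (D 0 x0)
    (fun x => (\1_(stop_short i e) x * Phi (lam i x) * v x)%:E).
  apply/measurable_EFinP; apply: measurable_funTS; do 2?apply: measurable_funM => //.
  by apply: measurable_indic; exact: measurable_stop_short.
have mG i e : measurable_fun (D 0 x0) (G i e).
  by rewrite /G; under eq_fun do rewrite EFinM; exact: measurable_funeM.
have mH i e : measurable_fun (D 0 x0) (H i e).
  by rewrite /H; under eq_fun do rewrite EFinM; exact: measurable_funeM.
have sum0 (u : nat -> nat -> T -> \bar R) : (forall i e x, 0 <= u i e x)%E ->
    forall i x, (0 <= \sum_(e <oo) u i e x)%E.
  by move=> u0 i x; apply: nneseries_ge0.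
have msum (u : nat -> nat -> T -> \bar R) : (forall i e x, 0 <= u i e x)%E ->
    (forall i e, measurable_fun (D 0 x0) (u i e)) ->
    forall i, measurable_fun (D 0 x0) (fun x => \sum_(e <oo) u i e x)%E.
  by move=> u0 mu_ i; apply: ge0_emeasurable_sum => [e x _ _|e _]; [exact: u0|exact: mu_].
have int2 (u : nat -> nat -> T -> \bar R) : (forall i e x, 0 <= u i e x)%E ->
    (forall i e, measurable_fun (D 0 x0) (u i e)) ->
    (\int[mu]_(x in D 0 x0) \sum_(i <oo) \sum_(e <oo) u i e x =
     \sum_(i <oo) \sum_(e <oo) \int[mu]_(x in D 0 x0) u i e x)%E.
  move=> u0 mu_; rewrite integral_nneseries//; last 2 first.
  - by move=> i; exact: msum.
  - by move=> i x _; exact: sum0.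
  by apply: eq_eseriesr => i _; rewrite integral_nneseries.
apply: (@le_trans _ _ (\int[mu]_(x in D 0 x0) \sum_(i <oo) \sum_(e <oo) G i e x)%E).
  apply: ae_ge0_le_integral => //.
  - by move=> x _; rewrite lee_fin mulr_ge0// Phi_ge0.
  - have mm : measurable_fun setT (m 0).
      by apply: (@measurable_cell_fun _ _ 0) => x y; exact: m_cell.
    apply/measurable_EFinP; apply: measurable_funTS; apply: measurable_funM => //.
    by apply: (measurableT_comp mPhi); exact: measurable_funB.
  - by move=> x _; apply: nneseries_ge0 => i _ _; exact: sum0.
  - by apply: ge0_emeasurable_sum => [i x _ _|i _]; [exact: sum0|exact: msum].
  have := ae_last_anchor x0; apply: negligibleS => x /= nle; split.
    by apply: contrapT => nx; apply: nle.
  move=> [j st fj]; apply: nle => _; exact: Phi_deviation_series st fj.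
rewrite int2//.
apply: (@le_trans _ _ ((c0 ^+ p.+2 * CF * B)%:E *
    \int[mu]_(x in D 0 x0) \sum_(i <oo) \sum_(e <oo) H i e x)%E); last first.
  apply: lee_wpmul2l; first by rewrite lee_fin mulr_ge0// mulr_ge0// exprn_ge0.
  apply: le_integral_lower => x x0x.
    by apply: nneseries_ge0 => i _ _; exact: sum0.
  by apply: stop_short_series => k; exact: PhiL.
rewrite int2// -nneseriesZl; last first.
  by move=> i _; apply: nneseries_ge0 => e _ _; exact: integral_ge0.
apply: lee_nneseries => [i _ _|i _].
  by apply: nneseries_ge0 => e _ _; exact: integral_ge0.
rewrite -nneseriesZl; last by move=> e _; exact: integral_ge0.
apply: lee_nneseries => [e _ _|e _]; first exact: integral_ge0.
have ge0l e' : 0 <= c0 ^+ e' by rewrite exprn_ge0.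
rewrite /G; under eq_integral do rewrite EFinM.
rewrite ge0_integralZl//; last 2 first.
- by move=> x _; rewrite lee_fin !mulr_ge0 ?indicE ?Phi_ge0.
- by rewrite lee_fin.
rewrite /H; under [in leRHS]eq_integral do rewrite EFinM.
rewrite ge0_integralZl//; last 2 first.
- by move=> x _; rewrite lee_fin !mulr_ge0 ?indicE ?Phi_ge0.
- by rewrite lee_fin !mulr_ge0 ?exprn_ge0//.
apply: le_trans (lee_wpmul2l _ (integral_stop_reaching_le i e x0)) _; first by rewrite lee_fin.
rewrite !muleA -!EFinM; apply: lee_wpmul2r.
  by apply: integral_ge0 => x _; rewrite lee_fin !mulr_ge0 ?indicE ?Phi_ge0.
rewrite lee_fin le_eqVlt; apply/orP; left; apply/eqP.
have -> : ((s / theta) ^+ e) `^ beta = ((s / theta) `^ beta) ^+ e.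
  by rewrite -!powR_mulrn ?powR_ge0 ?rho_ge0// powRAC.
by rewrite /gam exprMn exprD; field; rewrite gt_eqF.
Qed.

End stopping_time.

(** * Functions satisfying condition C, and numerical constants *)

Section growth_functions.
Context {R : realType} (Phi : R -> R) (c0 : R).
Hypothesis PhiC : condition_C Phi c0.

Lemma condition_C_homo x y : 0 <= x -> x <= y -> Phi x <= Phi y.
Proof.
have [_ h _ _] := PhiC; move=> x0 xy.
by apply: h => //; rewrite in_itv /= andbT //; exact: le_trans xy.
Qed.

Lemma condition_C_ge0 x : 0 <= x -> 0 <= Phi x.
Proof.
by have [_ _ h0 _] := PhiC; move=> x0; rewrite -h0; exact: condition_C_homo.
Qed.

Lemma condition_C_double c x : c0 <= c -> 0 <= x -> Phi (2 * x) <= c * Phi x.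
Proof.
have [_ _ h0 hd] := PhiC.
move=> cc; rewrite le_eqVlt => /predU1P[<-|x0]; first by rewrite mulr0 h0 mulr0.
by apply: le_trans (hd _ x0) _; apply: ler_wpM2r => //; exact/condition_C_ge0/ltW.
Qed.

Lemma continuous_Phi_norm : continuous (fun x : R => Phi `|x|).
Proof.
have [/continuous_within_itvcyP[cP cP0] _ h0 _] := PhiC.
move=> x; have [->|x0] := eqVneq x 0; last first.
  apply: (@continuous_comp _ _ _ (fun y : R => `|y|) Phi).
    exact: norm_continuous.
  by apply: cP; rewrite in_itv /= andbT normr_gt0.
apply/cvgrPdist_lt => e e0; rewrite normr0.
move/cvgrPdist_lt : cP0 => /(_ e e0) [d /= d0 hd].
exists d => //= y; rewrite /ball_ /= sub0r normrN => yd.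
have [->|y0] := eqVneq y 0; first by rewrite normr0 subrr normr0.
by apply: hd; rewrite /ball_ /= ?sub0r ?normrN ?normr_id ?normr_gt0.
Qed.

Lemma measurable_Phi_norm : measurable_fun setT (fun x : R => Phi `|x|).
Proof. by apply: continuous_measurable_fun; exact: continuous_Phi_norm. Qed.

Lemma measurable_Phi_deviation d (T : measurableType d) (f w : T -> R) (m : R) (A : set T) :
  measurable_fun setT f -> measurable_fun setT w ->
  measurable_fun A (fun x => (Phi `|f x - m| * w x)%:E).
Proof.
move=> mf mw; apply/measurable_EFinP; apply: measurable_funTS; apply: measurable_funM => //.
by apply: (measurableT_comp measurable_Phi_norm); exact: measurable_funB.
Qed.

Lemma extend_ge0 y : (0 <= extend Phi y)%E \/ (y < 0)%E.
Proof.
case: y => [r| |] /=; last by left.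
  by have [r0|r0] := leP 0 r; [left|right]; rewrite ?lee_fin ?lte_fin ?condition_C_ge0.
left; apply: le_trans (ereal_sup_ubound _); last by exists 0 => //=; rewrite in_itv /= lexx.
by rewrite lee_fin condition_C_ge0.
Qed.

Lemma le_extend r y : 0 <= r -> (r%:E <= y)%E -> ((Phi r)%:E <= extend Phi y)%E.
Proof.
move=> r0; case: y => [z| |] //= rz; first by rewrite lee_fin in rz *; exact: condition_C_homo.
by apply: ereal_sup_ubound; exists r => //=; rewrite in_itv /= r0.
Qed.

Lemma extend_homo y z : (0 <= y)%E -> (y <= z)%E -> (extend Phi y <= extend Phi z)%E.
Proof.
case: y => [r| |] //=; first by rewrite lee_fin => r0 /(le_extend r0).
by rewrite leye_eq => _ /eqP ->.
Qed.

End growth_functions.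

Section numerical_constants.
Context {R : realType}.

(** The series is summed by telescoping: the constants [a] and [b] solve
    [a i + b - g (a (i + 1) + b) = i + q] for all [i]. *)
Lemma sum_expr_linear_bounded (g : R) (q : nat) : 0 <= g < 1 ->
  exists2 B : R, 0 < B & forall N, \sum_(i < N) g ^+ i * (i + q)%:R <= B.
Proof.
move=> /andP[g0 g1].
have r0 : 0 < 1 - g by rewrite subr_gt0.
pose a : R := (1 - g)^-1; pose b : R := (q%:R + g * a) / (1 - g).
have a0 : 0 < a by rewrite invr_gt0.
have b0 : 0 <= b by rewrite divr_ge0 ?(ltW r0)// addr_ge0// mulr_ge0// ltW.
exists (b + 1); first by rewrite ltr_wpDl.
suff H N : \sum_(i < N) g ^+ i * (i + q)%:R = b - g ^+ N * (a * N%:R + b).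
  move=> N; rewrite H; have : 0 <= g ^+ N * (a * N%:R + b).
    by rewrite mulr_ge0 ?exprn_ge0// addr_ge0// mulr_ge0// ltW.
  by lra.
elim: N => [|N IH]; first by rewrite big_ord0 expr0 mulr0 add0r mul1r subrr.
rewrite big_ord_recr /= IH exprS -natr1 natrD /b /a; field.
by rewrite gt_eqF.
Qed.

Lemma exists_expr_le (r e : R) : 0 <= r < 1 -> 0 < e -> exists q : nat, r ^+ q <= e.
Proof.
move=> /andP[r0 r1] e0.
have : GRing.exp r @ \oo --> (0 : R) by apply: cvg_expr; rewrite ger0_norm.
move=> /cvgrPdist_lt /(_ e e0) [q _ /(_ q (leqnn _))] /=.
by rewrite sub0r normrN ger0_norm ?exprn_ge0// => /ltW; exists q.
Qed.

Lemma exists_expr2_ge (x : R) : exists p : nat, x <= 2 ^+ p.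
Proof.
exists (Num.truncn x).+1; apply: ltW; apply: lt_le_trans (truncnS_gt x) _.
by rewrite -natrX ler_nat ltnW// ltn_expl.
Qed.

End numerical_constants.

(** * The estimate on one cube *)

Section grid_application.
Context {R : realType} {n : nat}.
Local Notation Rn := 'rV[R]_n.+1.
Local Notation LRn := (lebesgueRn R n).
Local Notation mu := (@lebesgue R n).
Context (f : LRn -> R) (s t : R).
Hypothesis mf : measurable_fun setT f.
Hypothesis s_gt0 : 0 < s.
Hypothesis s_lt_t : s < t.
Hypothesis st_lt1 : s + t < 1.
Context (a : Rn) (l : R).
Hypothesis l0 : 0 < l.

(** The oscillation is taken relative to the cube of level 0 around [x], rather
    than to a fixed cube, so that its properties hold at every point of the
    space. *)
Definition grid_median k x : R := median f t (dyadic_cube a l k x).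
Definition grid_oscillation k x : R :=
  sup_oscillation f s (dyadic_cube a l 0 x) (dyadic_cube a l k x).

Lemma dyadic_cube_cube k x : cube (dyadic_cube a l k x).
Proof. by exists (dyadic_corner a l k x), (side l k); split => //; exact: side_gt0. Qed.

Lemma dyadic_cubeS k x : dyadic_cube a l k.+1 x `<=` dyadic_cube a l k x.
Proof.
move=> y xy i; have := xy i; have [] := dyadic_cornerS a l0 k x i.
by rewrite ![(_ + _ : 'rV_ _) _ _]mxE ![const_mx _ _ _]mxE; lra.
Qed.

Lemma dyadic_cube0 k x : dyadic_cube a l k x `<=` dyadic_cube a l 0 x.
Proof. by elim: k => // k IH; exact: subset_trans (@dyadic_cubeS k x) IH. Qed.

Lemma dyadic_code_eq k x y : dyadic_code a l k x = dyadic_code a l k y ->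
  dyadic_index a l k x = dyadic_index a l k y.
Proof. by move/(pcan_inj pickleK). Qed.

Lemma dyadic_code_nested k x y : dyadic_code a l k.+1 x = dyadic_code a l k.+1 y ->
  dyadic_code a l k x = dyadic_code a l k y.
Proof. by move/dyadic_code_eq/(dyadic_nested l0); rewrite /dyadic_code => ->. Qed.

Lemma eq_dyadic_cube k x y : dyadic_code a l k x = dyadic_code a l k y ->
  dyadic_cube a l k x = dyadic_cube a l k y.
Proof. by move/dyadic_code_eq => xy; rewrite /dyadic_cube /dyadic_corner xy. Qed.

Lemma dyadic_code_nested0 k x y : dyadic_code a l k x = dyadic_code a l k y ->
  dyadic_code a l 0 x = dyadic_code a l 0 y.
Proof. by elim: k => // k IH /dyadic_code_nested. Qed.

Lemma grid_median_cell k x y : dyadic_code a l k x = dyadic_code a l k y ->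
  grid_median k x = grid_median k y.
Proof. by move=> xy; rewrite /grid_median (eq_dyadic_cube xy). Qed.

Lemma grid_oscillation_cell k x y : dyadic_code a l k x = dyadic_code a l k y ->
  grid_oscillation k x = grid_oscillation k y.
Proof.
move=> xy; rewrite /grid_oscillation (eq_dyadic_cube xy).
by rewrite (eq_dyadic_cube (dyadic_code_nested0 xy)).
Qed.

Lemma grid_oscillation_ge0 k x : 0 <= grid_oscillation k x.
Proof.
apply: sup_oscillation_ge0 => //; try exact: dyadic_cube_cube.
exact: dyadic_cube0.
Qed.

Lemma grid_oscillationS k x : grid_oscillation k x <= grid_oscillation k.+1 x.
Proof.
apply: sup_oscillation_homo => //; try exact: dyadic_cube_cube.
  exact: dyadic_cubeS.
exact: dyadic_cube0.
Qed.

Lemma same_cell_dyadic k x : same_cell (dyadic_code a l) k x = dyadic_cell a l k x.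
Proof. exact: dyadic_code_fiber. Qed.

Lemma lebesgue_cell_cube k x :
  mu (dyadic_cell a l k x) = mu (dyadic_cube a l k x).
Proof. by rewrite lebesgue_dyadic_cell// lebesgue_dyadic_cube. Qed.

Lemma grid_deviates_small k x :
  (mu (same_cell (dyadic_code a l) k x `&` deviates f grid_median grid_oscillation k x)
   <= s%:E * mu (same_cell (dyadic_code a l) k x))%E.
Proof.
rewrite same_cell_dyadic lebesgue_cell_cube.
have cC := dyadic_cube_cube k x; have mC := cube_measurable cC.
have /andP[C0 Cfin] := cube_measure cC.
have osc : (oscillation s f (dyadic_cube a l k x) <= (grid_oscillation k x)%:E)%E.
  apply: oscillation_le_sup => //; first exact: dyadic_cube_cube.
  exact: dyadic_cube0.
apply: le_trans (median_center mf (ltW s_lt_t) st_lt1 mC Cfin C0 osc).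
apply: le_measure; rewrite ?inE.
- apply: measurableI; first exact: measurable_dyadic_cell.
  exact: measurable_deviates.
- exact: measurable_exceed.
- by move=> y [/(dyadic_cell_subcube l0) xy dy]; split.
Qed.

Lemma grid_median_step M k x : (0 < M)%N -> s * (1 + (1 + M%:R^-1) ^+ n.+1) < 1 ->
  `|grid_median k.+1 x - grid_median k x| <= 4 * M%:R * grid_oscillation k.+1 x.
Proof.
move=> M0 sM; rewrite /grid_median /grid_oscillation.
have -> : dyadic_cube a l k x =
    box (dyadic_corner a l k x) (dyadic_corner a l k x + const_mx (2 * side l k.+1)).
  by rewrite -sideS.
apply: (@median_double_cube R n f s t) => //.
- exact: ltW.
- exact: side_gt0.
- exact: dyadic_cube_cube.
- by move=> i; have := dyadic_cornerS a l0 k x i; rewrite [side l k]sideS.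
- by rewrite -sideS; exact: (@dyadic_cube0 k x).
Qed.

Lemma grid_root : dyadic_cube a l 0 a = box a (a + const_mx l).
Proof.
rewrite /dyadic_cube (_ : dyadic_corner a l 0 a = a); first by rewrite /side expr0 divr1.
by apply/rowP => i; rewrite !mxE subrr mul0r floor0 mulr0 addr0.
Qed.

Lemma eq_dyadic_cube_cell k x y : dyadic_cell a l k x y ->
  dyadic_cube a l k y = dyadic_cube a l k x.
Proof. by move=> xy; rewrite /dyadic_cube /dyadic_corner xy. Qed.

Lemma grid_oscillation_le_sharp k x : dyadic_cell a l 0 a x ->
  ((grid_oscillation k x)%:E <= sharp_maximal s (box a (a + const_mx l)) f x)%E.
Proof.
move=> ax; rewrite /grid_oscillation (eq_dyadic_cube_cell ax) grid_root.
apply: sup_oscillation_le_sharp => //.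
- by exists a, l.
- exact: dyadic_cube_cube.
- by rewrite -grid_root -(eq_dyadic_cube_cell ax); exact: dyadic_cube0.
- exact: (dyadic_cell_subcube l0).
Qed.

(** Instance of [stopping_time_estimate]. The closed cube and its half-open root
    cell differ by a null set. *)
Lemma grid_estimate (w v : LRn -> R) (Phi : R -> R) (c0 c beta alpha c1 CF B : R)
    (M N p q : nat) (L : LRn -> \bar R) :
  measurable_fun setT w -> measurable_fun setT v ->
  (forall x, 0 <= w x) -> (forall x, 0 <= v x) ->
  condition_C Phi c0 -> c0 <= c -> 1 <= c ->
  (0 < M)%N -> s * (1 + (1 + M%:R^-1) ^+ n.+1) < 1 -> 4 + 4 * M%:R <= 2 ^+ p :> R ->
  0 < c1 -> 0 < beta -> 0 < alpha < 1 ->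
  (forall Q E : set LRn, cube Q -> measurable E -> E `<=` Q ->
    (mu E <= alpha%:E * mu Q)%E ->
    (\int[mu]_(x in E) (w x)%:E <=
     (c1 * (fine (mu E) / fine (mu Q)) `^ beta)%:E *
     \int[mu]_(x in Q `\` E) (v x)%:E)%E) ->
  2 / alpha <= N%:R -> CF = N.+1%:R * c1 * alpha `^ (- beta) ->
  (s / (1 - t)) ^+ q <= alpha / 2 -> 0 < B ->
  (forall N, \sum_(i < N) (c * (s / (1 - t)) `^ beta) ^+ i * (i + q)%:R <= B) ->
  (forall k x, dyadic_cell a l 0 a x -> ((Phi (grid_oscillation k x))%:E <= L x)%E) ->
  (forall x, (0 <= L x)%E) ->
  (\int[mu]_(x in box a (a + const_mx l))
     (Phi `|f x - median f t (box a (a + const_mx l))| * w x)%:E <=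
   (c ^+ p.+2 * CF * B)%:E *
   \int[mu]_(x in box a (a + const_mx l)) (L x * (v x)%:E))%E.
Proof.
move=> mw mv w0 v0 PhiC c0c c_ge1 M0 sM Mp c1_gt0 beta_gt0 alpha01 F Na CFE q_small B0 B_bound PhiL L0.
have CF0 : 0 <= CF by rewrite CFE !mulr_ge0 ?powR_ge0// ltW.
pose Q : set LRn := box a (a + const_mx l); rewrite -/Q.
have DQ : dyadic_cell a l 0 a `<=` Q by rewrite /Q -grid_root; exact: dyadic_cell_subcube.
have mD : measurable (dyadic_cell a l 0 a) by exact: measurable_dyadic_cell.
have mQ : measurable (Q : set LRn) by exact: measurable_box.
have QDnull : mu (Q `\` dyadic_cell a l 0 a) = 0%E.
  apply: measure_negligible; first exact: measurableD.
  by rewrite /Q -grid_root; exact: negligible_cube_cell.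
have int0 x : Q x -> (0 <= (Phi `|f x - median f t Q| * w x)%:E)%E.
  by move=> _; rewrite lee_fin mulr_ge0// (condition_C_ge0 PhiC).
rewrite (ge0_integral_null_diff mD mQ DQ QDnull (measurable_Phi_deviation PhiC _ mf mw) int0).
have -> : (\int[mu]_(x in dyadic_cell a l 0 a) (Phi `|f x - median f t Q| * w x)%:E =
  \int[mu]_(x in dyadic_cell a l 0 a) (Phi `|f x - grid_median 0 x| * w x)%:E)%E.
  apply: eq_integral => x /set_mem xa.
  by rewrite /grid_median (eq_dyadic_cube_cell xa) grid_root.
apply: (@le_trans _ _ ((c ^+ p.+2 * CF * B)%:E *
   \int[mu]_(x in dyadic_cell a l 0 a) (L x * (v x)%:E))%E); last first.
  apply: lee_wpmul2l.
    rewrite lee_fin mulr_ge0 ?(ltW B0)// mulr_ge0// exprn_ge0//.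
    exact: le_trans c_ge1.
  by apply: le_integral_lower_subset => // x _; rewrite mule_ge0// lee_fin.
rewrite -same_cell_dyadic.
have theta_gt : s < 1 - t by move: st_lt1; lra.
have sth : s + (1 - t) < 1 by move: s_lt_t; lra.
apply: (@stopping_time_estimate _ _ _ mu (dyadic_code a l) _ _ _ _ f grid_median
  grid_oscillation s (1 - t) (4 * M%:R) mf grid_median_cell grid_oscillation_cell
  grid_oscillation_ge0 grid_oscillationS s_gt0 theta_gt sth _ grid_deviates_small
  _ _ Phi c p _ _ _ _ _ _ w v CF beta (alpha / 2) B q).
- by move=> k j; exact: measurable_dyadic_code.
- exact: dyadic_code_nested.
- by move=> k x; rewrite same_cell_dyadic lebesgue_dyadic_cell// ltry.
- by move=> k x; rewrite same_cell_dyadic lebesgue_dyadic_cell// lte_fin exprn_gt0// side_gt0.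
- by rewrite mulr_ge0.
- by move=> k x; exact: grid_median_step.
- move=> A k0 mA Afin dA; apply: (dyadic_density l0 mA Afin (a := a) (theta := 1 - t) (k0 := k0)).
    by apply/andP; split; move: s_gt0 st_lt1 s_lt_t; lra.
  by move=> k x k0k Ax; have := dA k x k0k Ax; rewrite same_cell_dyadic.
- by case: PhiC.
- exact: (condition_C_homo PhiC).
- by move=> x; exact: (condition_C_double PhiC).
- exact: (measurable_Phi_norm PhiC).
- exact: c_ge1.
- exact: Mp.
- exact: mw.
- exact: mv.
- exact: w0.
- exact: v0.
- exact: CF0.
- move=> k x E E' r mE mE' E'E; rewrite same_cell_dyadic CFE => ED r0 Er E'a.
  apply: (@weights_on_cells R n w v mw mv w0 v0 c1 beta alpha c1_gt0 beta_gt0 alpha01 F N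
    (dyadic_cube a l k x)) => //.
  + exact: dyadic_cube_cube.
  + exact: measurable_dyadic_cell.
  + exact: dyadic_cell_subcube.
  + exact: negligible_cube_cell.
  + exact: lebesgue_cell_cube.
- exact: q_small.
- exact: B0.
- exact: B_bound.
- by move=> k x; rewrite same_cell_dyadic; exact: PhiL.
Qed.

End grid_application.

(** * From cubes to the whole space *)

Section exhausting_cubes.
Context {R : realType} {n : nat}.
Local Notation Rn := 'rV[R]_n.+1.
Local Notation LRn := (lebesgueRn R n).

Definition central_corner N : Rn := const_mx (- N.+1%:R).
Definition central_side N : R := 2 * N.+1%:R.
Definition central_cube N : set LRn :=
  box (central_corner N) (central_corner N + const_mx (central_side N)).

Lemma central_side_gt0 N : 0 < central_side N.
Proof. by rewrite mulr_gt0. Qed.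

Lemma central_cubeP N x : central_cube N x <-> forall i, `|x 0 i| <= N.+1%:R.
Proof.
split=> h i; have := h i; rewrite !mxE /central_side ler_norml.
  by move=> /andP[? ?]; apply/andP; split; lra.
by move=> /andP[? ?]; apply/andP; split; lra.
Qed.

Lemma central_cube_cube N : cube (central_cube N).
Proof. by exists (central_corner N), (central_side N); split => //; exact: central_side_gt0. Qed.

Lemma cvg_central_cube : central_cube @ \oo --> (@cubes_to_Rn R n).
Proof.
move=> P [Q0 [a [l [l0 ->]]] PQ].
pose B := \sum_i `|a 0 i| + l.
exists (Num.truncn B) => // N BN; apply: PQ; first exact: central_cube_cube.
move=> x xQ; apply/central_cubeP => i.
have ai : `|a 0 i| <= \sum_i `|a 0 i| by rewrite (bigD1 i)//= lerDl sumr_ge0.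
have BN1 : B <= N.+1%:R.
  by apply: le_trans (ltW (truncnS_gt B)) _; rewrite ler_nat ltnS.
have := xQ i; rewrite !mxE => /andP[h1 h2].
have := ler_norm (a 0 i); have := ler_norm (- a 0 i); rewrite normrN /B in BN1 *.
move=> h3 h4; rewrite ler_norml; apply/andP; split; lra.
Qed.

Lemma central_cube_eventually x : exists N0, forall N, (N0 <= N)%N -> central_cube N x.
Proof.
exists (Num.truncn (\sum_i `|x 0 i|)) => N h; apply/central_cubeP => i.
apply: (@le_trans _ _ (\sum_i `|x 0 i|)).
  by rewrite (bigD1 i)//= lerDl sumr_ge0.
by apply: le_trans (ltW (truncnS_gt _)) _; rewrite ler_nat ltnS.
Qed.

End exhausting_cubes.

Lemma le_sharp_maximal {R : realType} {n : nat} (s : R) (Q : set (lebesgueRn R n))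
    (f : lebesgueRn R n -> R) x :
  (sharp_maximal s Q f x <= sharp_maximal s setT f x)%E.
Proof. by apply: ereal_sup_le => _ [P [cP _ Px] <-]; exists P => //; split. Qed.

Lemma sharp_maximal_ge0 {R : realType} {n : nat} (s : R) (Q : set (lebesgueRn R n))
    (f : lebesgueRn R n -> R) x : cube Q -> Q x -> (0 <= sharp_maximal s Q f x)%E.
Proof.
move=> cQ Qx; apply: le_trans (oscillation_ge0 f s Q) _.
by apply: ereal_sup_ubound; exists Q => //; split.
Qed.

Section global_from_local.
Context d (T : measurableType d) (R : realType) (mu : {measure set T -> \bar R}).
Context (Phi : R -> R) (c0 : R) (f w : T -> R) (Q : nat -> set T) (m : nat -> R) (I : \bar R).

(** Fatou's lemma along sets that exhaust the space, with the continuity of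
    [Phi] to let the centers [m N] tend to 0. *)
Lemma global_from_local : condition_C Phi c0 ->
  measurable_fun setT f -> measurable_fun setT w -> (forall x, 0 <= w x) ->
  (forall N, measurable (Q N)) ->
  (forall x, exists N0, forall N, (N0 <= N)%N -> Q N x) ->
  m @ \oo --> (0 : R) ->
  (forall N, (\int[mu]_(x in Q N) (Phi `|f x - m N| * w x)%:E <= I)%E) ->
  (\int[mu]_x (Phi `|f x| * w x)%:E <= I)%E.
Proof.
move=> PhiC mf mw w0 mQ Qx m0 intQ.
pose g N x := (Phi `|f x - m N| * w x)%:E.
have g0 N x : (0 <= g N x)%E by rewrite lee_fin mulr_ge0// (condition_C_ge0 PhiC).
apply: (@le_trans _ _ (\int[mu]_x (limn_einf (fun N => (g N \_ (Q N)) x)))%E).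
  apply: le_integral_lower => x _; first by rewrite lee_fin mulr_ge0// (condition_C_ge0 PhiC).
  have gx : g N x @[N --> \oo] --> (Phi `|f x| * w x)%:E.
    apply: cvg_EFin; first exact: nearW.
    apply: cvgM; last exact: cvg_cst.
    have fm : f x - m N @[N --> \oo] --> f x - 0 by apply: cvgB => //; exact: cvg_cst.
    rewrite -[X in `|X|]subr0.
    exact: (cvg_comp _ _ fm (@continuous_Phi_norm R Phi c0 PhiC _)).
  have [N0 hN0] := Qx x.
  have gQ : (g N \_ (Q N)) x @[N --> \oo] --> (Phi `|f x| * w x)%:E.
    apply: cvg_trans gx; apply: near_eq_cvg; exists N0 => // N /= /hN0 QNx.
    by rewrite patchE mem_set.
  by have [-> _] := cvg_limn_einf_sup gQ.
apply: le_trans (fatou mu measurableT _ _) _.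
- move=> N; apply/(measurable_restrictT _ (mQ N)).
  exact: (measurable_Phi_deviation PhiC).
- by move=> N x _; rewrite patchE; case: ifP.
apply: limn_einf_le => N.
by rewrite -integral_mkcond.
Qed.

End global_from_local.

Theorem theorem3p1 (R : realType) (n : nat) (w v : lebesgueRn R n -> R)
    (c0 c1 beta s t : R)
    (hw : weight w) (hv : weight v) (hF : condition_F w v c1 beta)
    (hs : 0 < s <= 2^-1) (ht : 2^-1 < t < 1 - s)
    (hc0 : c0 * (s / (1 - t)) `^ beta < 1) :
  exists2 c : R, 0 < c &
    forall Phi : R -> R, condition_C Phi c0 ->
    forall f : lebesgueRn R n -> R, measurable_fun setT f ->
      (forall Q0 : set (lebesgueRn R n), cube Q0 ->
        (\int[lebesgue]_(x in Q0) (Phi `|f x - median f t Q0| * w x)%:E <=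
         c%:E * \int[lebesgue]_(x in Q0)
           (extend Phi (sharp_maximal s Q0 f x) * (v x)%:E))%E) /\
      (median f t Q @[Q --> cubes_to_Rn] --> (0 : R) ->
        (\int[lebesgue]_x (Phi `|f x| * w x)%:E <=
         c%:E * \int[lebesgue]_x
           (extend Phi (sharp_maximal s setT f x) * (v x)%:E))%E).
Proof.
have [w0 mw _] := hw; have [v0 mv _] := hv.
have [c1_gt0 beta_gt0 [alpha alpha01 F]] := hF.
have [/andP[s_gt0 s_half] /andP[t_half ts]] := (hs, ht).
have s_lt_t : s < t by exact: le_lt_trans t_half.
have st_lt1 : s + t < 1 by lra.
have s_lt_half : s < 2^-1 by lra.
have theta_gt0 : 0 < 1 - t by lra.
have rho_gt0 : 0 < s / (1 - t) by rewrite divr_gt0.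
have rho_lt1 : s / (1 - t) < 1 by rewrite ltr_pdivrMr// mul1r; lra.
(* A doubling constant below 1 may be raised to 1: condition C persists, and the
   ratio of the geometric series stays below 1 because s / (1 - t) < 1. *)
pose c := Num.max c0 1.
have c0c : c0 <= c by rewrite le_max lexx.
have c_ge1 : 1 <= c by rewrite le_max lexx orbT.
have g_lt1 : 0 <= c * (s / (1 - t)) `^ beta < 1.
  apply/andP; split; first by rewrite mulr_ge0 ?powR_ge0// (le_trans ler01).
  rewrite /c; case: (leP c0 1) => _ //; rewrite mul1r.
  have := @gt0_ltr_powR _ beta beta_gt0 (s / (1 - t)) 1.
  by rewrite powR1 !nnegrE (ltW rho_gt0) ler01 rho_lt1; apply.
have [alpha_gt0 _] := andP alpha01.
have [M M_gt0 sM] := small_dilation n.+1 s_gt0 s_lt_half.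
have [p Mp] := exists_expr2_ge (4 + 4 * M%:R : R).
have Na : 2 / alpha <= (Num.truncn (2 / alpha)).+1%:R by exact/ltW/truncnS_gt.
have [q rho_q] : exists q : nat, (s / (1 - t)) ^+ q <= alpha / 2.
  by apply: exists_expr_le; rewrite ?divr_gt0// (ltW rho_gt0).
have [B B_gt0 B_bound] := sum_expr_linear_bounded q g_lt1.
pose CF := (Num.truncn (2 / alpha)).+2%:R * c1 * alpha `^ (- beta).
have CF_gt0 : 0 < CF by rewrite !mulr_gt0// powR_gt0.
exists (c ^+ p.+2 * CF * B).
  by rewrite mulr_gt0// mulr_gt0// exprn_gt0// (lt_le_trans ltr01).
move=> Phi PhiC f mf.
have local Q0 : cube Q0 ->
    (\int[lebesgue]_(x in Q0) (Phi `|f x - median f t Q0| * w x)%:E <=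
     (c ^+ p.+2 * CF * B)%:E * \int[lebesgue]_(x in Q0)
       (extend Phi (sharp_maximal s Q0 f x) * (v x)%:E))%E.
  move=> cQ0; have [a [l [l0 Q0E]]] := cQ0.
  (* The value 0 outside Q0 makes L nonnegative everywhere: off Q0 the supremum
     defining the sharp maximal function is empty. *)
  pose L x := if x \in Q0 then extend Phi (sharp_maximal s Q0 f x) else 0%E.
  have L_ge0 x : (0 <= L x)%E.
    rewrite /L; case: ifPn => // /set_mem Q0x.
    by have [//|] := extend_ge0 PhiC (sharp_maximal s Q0 f x); rewrite ltNge sharp_maximal_ge0.
  rewrite [X in (_ <= _ * X)%E](_ : _ = \int[lebesgue]_(x in Q0) (L x * (v x)%:E))%E; last first.
    by apply: eq_integral => x xQ0; rewrite /L xQ0.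
  rewrite Q0E.
  apply: (grid_estimate mf s_gt0 s_lt_t st_lt1 l0 mw mv w0 v0 PhiC c0c c_ge1 M_gt0 sM Mp
    c1_gt0 beta_gt0 alpha01 F Na (erefl CF) rho_q B_gt0 B_bound) => // k x ax.
  have Q0x : Q0 x by rewrite Q0E -grid_root; exact: (dyadic_cell_subcube l0).
  rewrite /L mem_set//; apply: (le_extend PhiC); first exact: grid_oscillation_ge0.
  by rewrite Q0E; exact: grid_oscillation_le_sharp.
split; first exact: local.
move=> med0.
apply: (@global_from_local _ _ _ lebesgue Phi c0 f w central_cube
  (fun N => median f t (central_cube N))) => //.
- by move=> N; apply: cube_measurable; exact: central_cube_cube.
- exact: central_cube_eventually.
- exact: cvg_comp cvg_central_cube med0.
move=> N; have cN : cube (central_cube N : set (lebesgueRn R n)) by exact: central_cube_cube.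
apply: le_trans (local _ cN) _; apply: lee_wpmul2l.
  rewrite lee_fin; apply: ltW.
  by rewrite mulr_gt0// mulr_gt0// exprn_gt0// (lt_le_trans ltr01).
have ext_ge0 K x : K x -> cube K -> (0 <= extend Phi (sharp_maximal s K f x))%E.
  by move=> Kx cK; have [//|] := extend_ge0 PhiC (sharp_maximal s K f x);
    rewrite ltNge sharp_maximal_ge0.
have ext_le K x : K x -> cube K ->
    (extend Phi (sharp_maximal s K f x) <= extend Phi (sharp_maximal s setT f x))%E.
  by move=> Kx cK; apply: (extend_homo PhiC); [exact: sharp_maximal_ge0|exact: le_sharp_maximal].
rewrite [leLHS]integral_mkcond; apply: le_integral_lower => x _; rewrite patchE.
  by case: ifP => // /set_mem Nx; rewrite mule_ge0 ?ext_ge0// lee_fin.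
case: ifP => [/set_mem Nx|_]; first by apply: lee_wpmul2r; [rewrite lee_fin|exact: ext_le].
have [N0 hN0] := central_cube_eventually x.
have xN0 : central_cube N0 x by exact: hN0.
apply: mule_ge0; last by rewrite lee_fin.
by apply: le_trans (ext_le _ _ xN0 _); rewrite ?ext_ge0//; exact: central_cube_cube.
Qed.
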